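(* Each maximal ideal in $H^\infty(\mathbb{D})$ that corresponds to a complex homomorphism in $\partial_SH^\infty(\mathbb{D})$ is an $M$-ideal in $H^\infty(\mathbb{D})$; that is, for every $\psi\in\partial_SH^\infty(\mathbb{D})$, $\ker\psi$ is an $M$-ideal in $H^\infty(\mathbb{D})$.
   Context: $H^\infty(\mathbb{D})$ is the Banach algebra of bounded analytic functions on the open unit disc $\mathbb{D}$ with the supremum norm. $\mathcal{M}(H^\infty(\mathbb{D}))$ is its maximal ideal space (nonzero complex homomorphisms with the weak-$*$ topology), and $\hat f(\varphi)=\varphi(f)$ is the Gelfand transform. $\partial_SH^\infty(\mathbb{D})$ is the Šilov boundary: the smallest closed subset of $\mathcal{M}(H^\infty(\mathbb{D}))$ on which every $\hat f$, $f\in H^\infty(\mathbb{D})$, attains its maximum modulus. $M$-ideal: a closed subspace $C$ of a complex Banach space $X$ is an $M$-ideal in $X$ if there is a bounded linear projection $P:X^*\to X^*$ ($P^2=P$) with $\operatorname{ran}P=C^\perp=\{x^*\in X^*: x^*|_C\equiv0\}$ and $\|Px^*\|+\|(I-P)x^*\|=\|x^*\|$ for all $x^*\in X^*$. *)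

(* Defs.v *)
From HB Require Import structures.
From mathcomp Require Import all_boot all_order all_algebra.
From mathcomp Require Import complex.
From mathcomp Require Import all_classical all_reals all_analysis.

Set Implicit Arguments.
Unset Strict Implicit.
Unset Printing Implicit Defensive.
Set Warnings "-redundant-canonical-projection".

Import Order.TTheory GRing.Theory Num.Theory.
Import numFieldNormedType.Exports.
Local Open Scope classical_set_scope.
Local Open Scope complex_scope.
Local Open Scope ring_scope.

(* R[i] as a normed algebra over itself; its balls are those of the modulus. *)
HB.instance Definition _ (R : realType) := GRing.ComAlgebra.copy R[i] R[i]^o.
HB.instance Definition _ (R : realType) := NormedModule.copy R[i] R[i]^o.

(* A norm over R[i] takes its values in R[i], so the real supremum is embedded
   back into R[i]. *)
Definition sup_norm (R : realType) (T : Type) (A : set T) (f : T -> R[i])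
  : R[i] := (sup [set complex.Re `|f t| | t in A])%:C.

Section sup_norm_theory.
Context (R : realType) (T : Type) (A : set T).
Implicit Types f g : T -> R[i].

Let bnd f := exists M : R[i], forall t, A t -> `|f t| <= M.

Lemma normc_ReE (z : R[i]) : (complex.Re `|z|)%:C = `|z|.
Proof. by rewrite normc_def. Qed.

Lemma sup_norm_ub f t : bnd f -> A t -> `|f t| <= sup_norm A f.
Proof.
move=> [M fM] At; rewrite -normc_ReE lecR; apply: ub_le_sup; last by exists t.
exists (complex.Re M) => _ [s As <-].
by have := fM s As; rewrite -normc_ReE lecE => /andP[_].
Qed.

Lemma sup_norm_le f (M : R[i]) : A !=set0 ->
  (forall t, A t -> `|f t| <= M) -> sup_norm A f <= M.
Proof.
move=> [t0 At0] fM.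
have M0 : 0 <= M by apply: le_trans (fM _ At0).
have <- : (complex.Re M)%:C = M by rewrite -(ger0_norm M0) normc_ReE.
rewrite lecR; apply: ge_sup; first by exists (complex.Re `|f t0|), t0.
by move=> _ [s As <-]; have := fM s As; rewrite -normc_ReE lecE => /andP[_].
Qed.

Lemma sup_norm_ge0 f : A !=set0 -> bnd f -> 0 <= sup_norm A f.
Proof. by move=> [t At] bf; apply: le_trans (sup_norm_ub bf At). Qed.

Lemma sup_normD f g : A !=set0 -> bnd f -> bnd g ->
  sup_norm A (f + g) <= sup_norm A f + sup_norm A g.
Proof.
move=> A0 bf bg; apply: sup_norm_le => // t At.
by apply: le_trans (ler_normD _ _) (lerD _ _); exact: sup_norm_ub.
Qed.

Lemma sup_normZ (a : R[i]) f : A !=set0 -> bnd f ->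
  sup_norm A (a *: f) = `|a| * sup_norm A f.
Proof.
move=> A0 bf.
have le b h : bnd h -> sup_norm A (b *: h) <= `|b| * sup_norm A h.
  move=> bh; apply: sup_norm_le => // t At.
  by rewrite normrM ler_wpM2l//; exact: sup_norm_ub.
have [->|a0] := eqVneq a 0.
  apply/eqP; rewrite eq_le (le 0 f bf)/= normr0 mul0r.
  apply: sup_norm_ge0 => //; exists 0 => t _.
  by rewrite scale0r normr0.
apply/eqP; rewrite eq_le le//= -ler_pdivlMl ?normr_gt0// -normfV.
have {1}-> : f = a^-1 *: (a *: f) by rewrite scalerA mulVf// scale1r.
apply: le; case: bf => M fM; exists (`|a| * M) => t At.
by rewrite normrM ler_wpM2l// fM.
Qed.

End sup_norm_theory.

Section disc.
Variable R : realType.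

Definition disc : set R[i] := [set z | `|z| < 1].

Lemma disc0 : disc 0.
Proof. by rewrite /disc /= normr0. Qed.

Lemma open_disc : open disc.
Proof.
rewrite (_ : disc = ball 0 1); first exact: ball_open.
by rewrite -ball_normE; apply/seteqP; split=> z; rewrite /disc/= sub0r normrN.
Qed.

HB.instance Definition _ := isPointed.Build disc (SigSub (mem_set disc0)).

(* ['valL_0 f] extends f by 0 outside the open disc, where complex
   differentiability does not see the extension. *)
Definition analytic_disc (f : disc -> R[i]) : Prop :=
  forall z : R[i], disc z -> derivable ('valL_0 f) z 1.

Definition bounded_disc (f : disc -> R[i]) : Prop :=
  exists M : R[i], forall z, `|f z| <= M.

Definition Hinf_pred : {pred disc -> R[i]} :=
  [pred f | `[< analytic_disc f /\ bounded_disc f >]].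

Record Hinf := MkHinf { Hinf_fun :> disc -> R[i]; _ : Hinf_fun \in Hinf_pred }.

HB.instance Definition _ := [isSub for Hinf_fun].
HB.instance Definition _ := [Choice of Hinf by <:].

Lemma analytic_disc_cst1 : analytic_disc 1.
Proof.
move=> z dz.
suff cst1E : {near z, (cst 1 : R[i] -> R[i]) =1 'valL_0 (1 : disc -> R[i])}.
  by apply: near_eq_derivable cst1E _; exact: derivable_cst.
have : \forall w \near z, disc w by exact: open_nbhs_nbhs (conj open_disc dz).
apply: filterS => w dw.
by rewrite /valL_/= oinv_set_val insubT ?inE.
Qed.

Lemma Hinf_mulr_closed : mulr_closed Hinf_pred.
Proof.
split.
  apply/asboolP; split; first exact: analytic_disc_cst1.
  by exists 1 => z; rewrite normr1.
move=> f g /asboolP[af [M fM]] /asboolP[ag [N gN]]; apply/asboolP; split.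
  move=> z dz; rewrite (_ : 'valL_0 _ = 'valL_0 f * 'valL_0 g).
    by apply: derivableM; [exact: af|exact: ag].
  apply/funext => w; rewrite -[RHS]/('valL_0 f w * 'valL_0 g w) /valL_/=.
  by case: ('oinv_set_val w) => //=; rewrite mulr0.
by exists (M * N) => z; rewrite normrM ler_pM.
Qed.

Lemma Hinf_submod_closed : submod_closed Hinf_pred.
Proof.
split.
  apply/asboolP; split; last by exists 0 => z; rewrite normr0.
  move=> z dz; rewrite (_ : 'valL_0 _ = cst 0); first exact: derivable_cst.
  by apply/funext => w; rewrite /valL_/=; case: ('oinv_set_val w).
move=> a f g /asboolP[af [M fM]] /asboolP[ag [N gN]]; apply/asboolP; split.
  move=> z dz; rewrite (_ : 'valL_0 _ = a \*: 'valL_0 f + 'valL_0 g).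
    by apply: derivableD; [apply: derivableZ; exact: af|exact: ag].
  apply/funext => w; rewrite -[RHS]/(a *: 'valL_0 f w + 'valL_0 g w) /valL_/=.
  by case: ('oinv_set_val w) => //=; rewrite scaler0 addr0.
exists (`|a| * M + N) => z.
by rewrite (le_trans (ler_normD _ _))// lerD// normrM ler_wpM2l.
Qed.

HB.instance Definition _ :=
  GRing.isSubmodClosed.Build R[i] (disc -> R[i]) Hinf_pred Hinf_submod_closed.
HB.instance Definition _ :=
  GRing.isMulClosed.Build (disc -> R[i]) Hinf_pred Hinf_mulr_closed.
HB.instance Definition _ := [SubChoice_isSubComNzRing of Hinf by <:].
HB.instance Definition _ := [SubZmodule_isSubLmodule of Hinf by <:].

Lemma Hinf_scalerAl (a : R[i]) (f g : Hinf) : a *: (f * g) = (a *: f) * g.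
Proof. by apply/val_inj/funext => z; exact: mulrA. Qed.

HB.instance Definition _ := GRing.Lmodule_isLalgebra.Build R[i] Hinf Hinf_scalerAl.
HB.instance Definition _ := GRing.Lalgebra_isComAlgebra.Build R[i] Hinf.

Let Hinf_norm (f : Hinf) : R[i] := sup_norm setT f.

Let Hinf_bnd (f : Hinf) : exists M : R[i], forall z, [set: disc] z -> `|f z| <= M.
Proof. by case: f => f /= /asboolP[_ [M fM]]; exists M => z _. Qed.

Let setT_disc : [set: disc] !=set0. Proof. by exists point. Qed.

Let Hinf_normD f g : Hinf_norm (f + g) <= Hinf_norm f + Hinf_norm g.
Proof. exact: sup_normD (setT_disc) (Hinf_bnd f) (Hinf_bnd g). Qed.

Let Hinf_normZ a f : Hinf_norm (a *: f) = `|a| * Hinf_norm f.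
Proof. exact: sup_normZ (setT_disc) (Hinf_bnd f). Qed.

Let Hinf_norm0_eq0 f : Hinf_norm f = 0 -> f = 0.
Proof.
move=> f0; apply/val_inj/funext => z; apply/eqP; rewrite -normr_le0 -f0.
exact: sup_norm_ub (Hinf_bnd f) _.
Qed.

HB.instance Definition _ := Lmodule_isNormed.Build R[i] Hinf
  Hinf_normD Hinf_normZ Hinf_norm0_eq0.

Lemma Hinf_normE (f : Hinf) : `|f| = sup_norm setT f.
Proof. by []. Qed.

End disc.

Section dual.
Context (R : realType) (X : normedModType R[i]).

Definition dual_pred : {pred X -> R[i]} :=
  [pred f | `[< linear f /\ continuous f >]].

Record dual := MkDual { dual_fun :> X -> R[i]; _ : dual_fun \in dual_pred }.

HB.instance Definition _ := [isSub for dual_fun].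
HB.instance Definition _ := [Choice of dual by <:].

Lemma dual_submod_closed : submod_closed dual_pred.
Proof.
split.
  by apply/asboolP; split; [move=> a u v; rewrite /= scaler0 addr0|exact: cst_continuous].
move=> a f g /asboolP[lf cf] /asboolP[lg cg]; apply/asboolP; split.
  move=> b u v; rewrite !fctE lf lg /= !scalerDr !scalerA addrACA.
  by rewrite (mulrC a b).
move=> x; apply: continuousD; last exact: cg.
by apply: continuousZl_tmp; exact: cf.
Qed.

HB.instance Definition _ :=
  GRing.isSubmodClosed.Build R[i] (X -> R[i]) dual_pred dual_submod_closed.
HB.instance Definition _ := [SubChoice_isSubLmodule of dual by <:].

Let unit_ball : set X := [set x | `|x| <= 1].

Let dual_norm (f : dual) : R[i] := sup_norm unit_ball f.

Let unit_ball_neq0 : unit_ball !=set0.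
Proof. by exists 0; rewrite /unit_ball /= normr0. Qed.

Lemma dual_linear (f : dual) : linear f.
Proof. by case: f => f /= /asboolP[]. Qed.

Lemma dual_continuous (f : dual) : continuous f.
Proof. by case: f => f /= /asboolP[]. Qed.

HB.instance Definition _ (f : dual) :=
  GRing.isLinear.Build R[i] X R[i] _ f (dual_linear f).

Let dual_bnd (f : dual) :
  exists M : R[i], forall x, unit_ball x -> `|f x| <= M.
Proof.
have fb : bounded_near f (nbhs (0 : X)).
  by apply: continuous_linear_bounded; exact: dual_continuous.
have [M M0 fM] := pinfty_ex_gt0 ((linear_boundedP f).1 fb).
exists M => x x1; apply: le_trans (fM x) _.
by rewrite ler_piMr// ltW.
Qed.

Let dual_normD f g : dual_norm (f + g) <= dual_norm f + dual_norm g.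
Proof. exact: sup_normD unit_ball_neq0 (dual_bnd f) (dual_bnd g). Qed.

Let dual_normZ a f : dual_norm (a *: f) = `|a| * dual_norm f.
Proof. exact: sup_normZ unit_ball_neq0 (dual_bnd f). Qed.

Let dual_norm0_eq0 f : dual_norm f = 0 -> f = 0.
Proof.
move=> f0; apply/val_inj/funext => x /=.
have [->|x0] := eqVneq x 0; first by rewrite linear0.
have : f (`|x|^-1 *: x) = 0.
  apply/eqP; rewrite -normr_le0 -f0; apply: sup_norm_ub (dual_bnd f) _.
  by rewrite /unit_ball /= normfZV.
rewrite linearZ /= => /eqP; rewrite scaler_eq0 invr_eq0 normr_eq0 (negbTE x0).
by move/eqP.
Qed.

HB.instance Definition _ := Lmodule_isNormed.Build R[i] dual
  dual_normD dual_normZ dual_norm0_eq0.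

Lemma dual_normE (f : dual) : `|f| = sup_norm [set x | `|x| <= 1] f.
Proof. by []. Qed.

Definition annihilator (C : set X) : set dual :=
  [set f | forall x, C x -> f x = 0].

Definition Mideal (C : set X) : Prop :=
  [/\ closed C, C 0, forall (a : R[i]) x y, C x -> C y -> C (a *: x + y) &
    exists P : {linear dual -> dual},
      [/\ continuous P, forall f, P (P f) = P f, range P = annihilator C &
          forall f, `|P f| + `|f - P f| = `|f|]].

End dual.

Section maximal_ideal_space.
Context (R : realType) (A : comAlgType R[i]).

Definition is_character (phi : A -> R[i]) : Prop :=
  [/\ linear phi, forall f g, phi (f * g) = phi f * phi g &
      exists f, phi f != 0].

(* The subtype of [{ptws A -> R[i]}] carries the topology induced by pointwise
   convergence, that is, the weak-* topology. *)
Definition max_ideal_space : set {ptws A -> R[i]} := is_character.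

Definition gelfand (f : A) (phi : max_ideal_space) : R[i] := \val phi f.

Definition char_ker (phi : max_ideal_space) : set A :=
  [set f | gelfand f phi = 0].

Definition is_boundary (E : set max_ideal_space) : Prop :=
  closed E /\
  forall f : A, exists2 phi, E phi &
    forall chi : max_ideal_space, `|gelfand f chi| <= `|gelfand f phi|.

(* [smallest is_boundary set0] is the intersection of all closed boundaries; by
   Silov's theorem it is itself a boundary when A is a commutative unital Banach
   algebra, and hence the smallest one. *)
Definition silov_boundary : set max_ideal_space := smallest is_boundary set0.

End maximal_ideal_space.

Arguments max_ideal_space {R} A.
Arguments silov_boundary {R} A.

(* Main.v *)
Require Import Defs.
Set Warnings "-notation-overridden,-ambiguous-paths,-notation-incompatible-prefix".
From HB Require Import structures.
From mathcomp Require Import all_boot all_order all_algebra zify ring lra.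
From mathcomp Require Import cyclic separable.
From mathcomp Require Import cyclotomic.
From mathcomp Require Import complex.
From mathcomp Require Import all_classical all_reals all_analysis.

(** Let psi be a character in the Silov boundary.  The kernel of psi has
codimension one, so a projection onto its annihilator has the form
F |-> c(F) psi, and c(F) is found as a limit of F(h) along functions h that
peak at psi: psi(h) = 1, h nearly annihilates the kernel (|h f| is uniformly
small for any finitely many f in it), and h(z) is uniformly close to the real
interval [0, 1], so that |h| + |1 - h| is at most 1 + e.  Indeed F(x) -
c(F) psi(x) is then the limit of F(x (1 - h)), and combining F(h) and
F(x (1 - h)) with unimodular coefficients gives
|c(F)| + |F(x) - c(F) psi(x)| <= ||F||, which is the L-projection property
(key step of [ker_Mideal]).

Values near [0, 1] cost nothing beyond the bound |h| <= 1: if h_1, ..., h_n are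
chosen successively so that each h_j is small wherever some earlier h_i is not
close to 1, then at every point all of them but one are close to 1 or close to
0, in this order, and their average is close to k/n for some k
([peak_chain], [peak_near_interval]).

Everything thus rests on [silov_peak]: for psi(f) = 0 and e > 0 there is h with
|h| <= 1, |h f| <= e and psi(h) = 1.  The candidate is the outer function h
with boundary modulus min(1, e/|f|), and the property that makes it work is
that for every d > 0 the set where |f| >= e or |h| >= 1 - d is so large that
every bounded analytic g satisfies on the disc any bound m that it satisfies on
this set ([outer_function]).  By limits of point evaluations, the characters
phi with |phi(f)| >= e or |phi(h)| >= 1 - d then form a closed boundary.  It
contains psi, whence |psi(h)| >= 1 - d for every d.

No boundary values are needed for h.  On a circle of radius r_n < 1 the
continuous function W = max(1, |f|/e) is nearly the modulus of a polynomial Q_n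
without zeros in the closed disc of radius r_n, and h is a limit of the
functions 1/Q_n as r_n tends to 1.  On the circle, |h| <= 1/W gives
|Q_n h| <= 1 up to a factor tending to 1; where |g| > m, moreover, W = 1 and
|h| < 1 - d.  Hence |g (Q_n h)^C| <= m on the circle up to a factor tending
to 1, for some fixed power C; the maximum principle carries this inside, and
there Q_n h tends to 1.

The only tool from complex analysis is therefore the maximum modulus principle
for functions that are merely complex differentiable at every point
([max_modulus]).  Goursat's bisection argument is carried out on Riemann sums
instead of integrals ([goursat]); in the coordinate exp it compares the average
of F over the unit circle with its average over a tiny circle, that is with
F(0), and a Moebius map moves 0 to any other point. *)

Set Implicit Arguments.
Unset Strict Implicit.
Unset Printing Implicit Defensive.
Import Order.TTheory GRing.Theory Num.Theory.
Import numFieldNormedType.Exports.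
Local Open Scope classical_set_scope.
Local Open Scope complex_scope.
Local Open Scope ring_scope.

(** * The real modulus of a complex number *)

Section modulus.
Context (R : realType).
Implicit Types (z w : R[i]) (x y : R).

(** The norm of R[i] takes values in R[i], whose order is partial; estimates are
    made with this real-valued modulus instead. *)
Definition cabs z : R := complex.Re `|z|.

Lemma cabsE z : `|z| = (cabs z)%:C.
Proof. by rewrite /cabs normc_ReE. Qed.

Lemma cabs_ge0 z : 0 <= cabs z.
Proof. by have := normr_ge0 z; rewrite cabsE ler0c. Qed.

Lemma cabsM z w : cabs (z * w) = cabs z * cabs w.
Proof. by apply: (@complexI R); rewrite rmorphM /= -!cabsE normrM. Qed.

Lemma cabsD z w : cabs (z + w) <= cabs z + cabs w.
Proof. by rewrite -lecR rmorphD /= -!cabsE ler_normD. Qed.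

Lemma cabsN z : cabs (- z) = cabs z.
Proof. by rewrite /cabs normrN. Qed.

Lemma cabsB z w : cabs (z - w) <= cabs z + cabs w.
Proof. by rewrite -(cabsN w) cabsD. Qed.

Lemma cabsC z w : cabs (z - w) = cabs (w - z).
Proof. by rewrite -cabsN opprB. Qed.

Lemma cabs_real x : cabs x%:C = `|x|.
Proof. by rewrite /cabs normc_def /= expr0n addr0 sqrtr_sqr. Qed.

Lemma cabs0 : cabs 0 = 0.
Proof. by rewrite /cabs normr0. Qed.

Lemma cabs1 : cabs 1 = 1.
Proof. by rewrite /cabs normr1. Qed.

Lemma cabs_eq0 z : (cabs z == 0) = (z == 0).
Proof. by rewrite -(normr_eq0 z) cabsE -(inj_eq (@complexI R)). Qed.

Lemma cabs_gt0 z : (0 < cabs z) = (z != 0).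
Proof. by rewrite lt_def cabs_eq0 cabs_ge0 andbT. Qed.

Lemma cabsX z n : cabs (z ^+ n) = cabs z ^+ n.
Proof.
by elim: n => [|n IH]; rewrite ?expr0 ?cabs1// !exprS cabsM IH.
Qed.

Lemma cabsV z : cabs z^-1 = (cabs z)^-1.
Proof. by apply: (@complexI R); rewrite fmorphV /= -!cabsE normfV. Qed.

Lemma cabs_conj z : cabs z^* = cabs z.
Proof. by rewrite /cabs normcJ. Qed.

Lemma cabs_nat n : cabs n%:R = n%:R.
Proof. by rewrite /cabs normr_nat -(rmorph_nat (real_complex R)). Qed.

Lemma cabs_sqr z : cabs z ^+ 2 = complex.Re z ^+ 2 + complex.Im z ^+ 2.
Proof.
by apply: (@complexI R); rewrite rmorphXn /= -cabsE -add_Re2_Im2.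
Qed.

Lemma cabs_sqrC z : ((cabs z) ^+ 2)%:C = z * z^*.
Proof. by rewrite rmorphXn /= -cabsE sqr_normc. Qed.

Lemma ler_Re z : `|complex.Re z| <= cabs z.
Proof.
by rewrite -(ler_pXn2r (n:=2)) ?nnegrE ?cabs_ge0// cabs_sqr real_normK ?num_real// lerDl sqr_ge0.
Qed.

Lemma ler_Im z : `|complex.Im z| <= cabs z.
Proof.
by rewrite -(ler_pXn2r (n:=2)) ?nnegrE ?cabs_ge0// cabs_sqr real_normK ?num_real// lerDr sqr_ge0.
Qed.

Lemma cabs_i : cabs ('i : R[i]) = 1.
Proof. by rewrite /cabs normc_def /= expr0n expr1n add0r sqrtr1. Qed.

Lemma cabs_le_ReIm z : cabs z <= `|complex.Re z| + `|complex.Im z|.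
Proof.
rewrite {1}(complexE z); apply: le_trans (cabsD _ _) _.
by rewrite cabs_real cabsM cabs_real cabs_i mul1r.
Qed.

Lemma ler_cabs_sum (I : Type) (s : seq I) (P : pred I) (F : I -> R[i]) :
  cabs (\sum_(i <- s | P i) F i) <= \sum_(i <- s | P i) cabs (F i).
Proof.
elim/big_rec2: _ => [|i x z _ H]; first by rewrite cabs0.
by apply: le_trans (cabsD _ _) _; rewrite lerD2l.
Qed.

Lemma cabs_dist z w : `|cabs z - cabs w| <= cabs (z - w).
Proof.
have := cabsD (z - w) w; have := cabsD (w - z) z; rewrite !subrK (cabsC w).
by rewrite ler_norml; lra.
Qed.

Lemma cabs_small0 z : (forall e, 0 < e -> cabs z <= e) -> z = 0.
Proof.
move=> H; apply/eqP; rewrite -cabs_eq0 eq_le cabs_ge0 andbT.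
by apply/ler_addgt0Pr => e e0; rewrite add0r H.
Qed.

End modulus.

(** * Limits along filters *)

Section ultra.
Context (R : realType).

Section filter.
Context {T : Type} (U : set_system T) {UF : ProperFilter U}.
Implicit Types (u v : T -> R[i]) (l k : R[i]).

Definition ucvg u l := forall e : R, 0 < e -> U [set t | cabs (u t - l) < e].

Lemma ucvg_cst l : ucvg (fun=> l) l.
Proof. by move=> e e0; apply: filterE => t /=; rewrite subrr cabs0. Qed.

Lemma ucvgD u v l k : ucvg u l -> ucvg v k -> ucvg (fun t => u t + v t) (l + k).
Proof.
move=> ul vk e e0; have e2 : 0 < e / 2 by rewrite divr_gt0.
apply: filterS2 (ul _ e2) (vk _ e2) => t /= H1 H2.
by rewrite opprD addrACA; apply: le_lt_trans (cabsD _ _) _; lra.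
Qed.

Lemma ucvgZ u a l : ucvg u l -> ucvg (fun t => a * u t) (a * l).
Proof.
move=> ul e e0; have a0 := cabs_ge0 a.
have e2 : 0 < e / (cabs a + 1) by rewrite divr_gt0// ltr_wpDl.
apply: filterS (ul _ e2) => t /= H1.
rewrite -mulrBr cabsM; have := cabs_ge0 (u t - l); move: H1.
rewrite ltr_pdivlMr ?ltr_wpDl//; nra.
Qed.

Lemma ucvgN u l : ucvg u l -> ucvg (fun t => - u t) (- l).
Proof.
move=> ul e e0; apply: filterS (ul _ e0) => t /=.
by rewrite -opprD cabsN.
Qed.

Lemma ucvg_le u l (M : R) : ucvg u l -> U [set t | cabs (u t) <= M] -> cabs l <= M.
Proof.
move=> ul uM; apply/ler_addgt0Pr => e e0.
have [t [/= H1 H2]] := filter_ex (filterI (ul _ e0) uM).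
have := cabsD (u t) (l - u t); rewrite addrC subrK (cabsC l); lra.
Qed.

Lemma ucvg_ge u l (M : R) : ucvg u l -> U [set t | M <= cabs (u t)] -> M <= cabs l.
Proof.
move=> ul uM; apply/ler_addgt0Pr => e e0.
have [t [/= H1 H2]] := filter_ex (filterI (ul _ e0) uM).
have := cabsD l (u t - l); rewrite addrC subrK; lra.
Qed.

Lemma ucvg_near u v l : ucvg u l -> (forall e : R, 0 < e -> U [set t | cabs (u t - v t) < e]) ->
  ucvg v l.
Proof.
move=> ul uv e e0; have e2 : 0 < e / 2 by rewrite divr_gt0.
apply: filterS2 (ul _ e2) (uv _ e2) => t /= H1 H2.
have -> : v t - l = (u t - l) - (u t - v t) by ring.
by apply: le_lt_trans (cabsB _ _) _; lra.
Qed.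

Lemma ucvg_eq u v l : ucvg u l -> U [set t | u t = v t] -> ucvg v l.
Proof.
move=> ul uv; apply: ucvg_near ul _ => e e0.
by apply: filterS uv => t /= ->; rewrite subrr cabs0.
Qed.

Lemma ucvg_uniq u l k : ucvg u l -> ucvg u k -> l = k.
Proof.
move=> ul uk; apply/eqP; rewrite -subr_eq0; apply/eqP/cabs_small0 => e e0.
apply: (ucvg_le (u := fun t => u t - u t)).
  by apply: ucvgD => //; exact: ucvgN.
by apply: filterE => t /=; rewrite subrr cabs0 ltW.
Qed.

Lemma ucvgM u v l k : ucvg u l -> ucvg v k -> ucvg (fun t => u t * v t) (l * k).
Proof.
move=> ul vk.
have H1 : ucvg (fun t => k * u t) (l * k) by rewrite mulrC; exact: ucvgZ.
apply: ucvg_near H1 _ => e e0.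
pose L := cabs l + 1; have L0 : 0 < L by rewrite ltr_wpDl// cabs_ge0.
apply: filterS2 (ul _ ltr01) (vk _ (divr_gt0 e0 L0)) => t /= H1 H2.
have -> : k * u t - u t * v t = u t * (k - v t) by ring.
rewrite cabsM cabsC; move: H2; rewrite ltr_pdivlMr// => H2.
have H3 : cabs (u t) < L.
  have := cabsD (u t - l) l; rewrite subrK /L; lra.
by have := cabs_ge0 (v t - k); have := cabs_ge0 (u t); nra.
Qed.

Lemma ucvgX u l (k : nat) : ucvg u l -> ucvg (fun t => u t ^+ k) (l ^+ k).
Proof.
move=> ul; elim: k => [|k IH]; first exact: ucvg_cst.
rewrite exprS (_ : (fun t => _) = (fun t => u t * u t ^+ k)); first exact: ucvgM.
by apply/funext => t; rewrite exprS.
Qed.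

Definition ulim u : R[i] := xget 0 [set l | ucvg u l].

Lemma ulimE u l : ucvg u l -> ulim u = l.
Proof.
move=> ul; apply: ucvg_uniq (ul).
exact: (@xgetPex _ 0 [set l | ucvg u l] (ex_intro _ l ul)).
Qed.

End filter.

(** For real x, the limit is the supremum of the c such that c <= x holds on a
    member of the ultrafilter: any larger c has x < c on a member, because an
    ultrafilter contains a set or its complement. *)
Lemma ultra_bounded_cvg {T : Type} (U : set_system T) {UU : UltraFilter U}
    (u : T -> R[i]) (M : R) : U [set t | cabs (u t) <= M] -> ucvg U u (ulim U u).
Proof.
have real (x : T -> R) : U [set t | `|x t| <= M] ->
    exists l : R, forall e, 0 < e -> U [set t | `|x t - l| < e].
  move=> xM.
  pose A := [set c : R | U [set t | c <= x t]].
  have Abnd : has_sup A.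
    split; first by exists (- M); apply: filterS xM => t /=; rewrite ler_norml => /andP[].
    exists M => c Ac; have [t [/= H1 H2]] := filter_ex (filterI Ac xM).
    by apply: le_trans H1 _; move: H2; rewrite ler_norml => /andP[].
  exists (sup A) => e e0.
  have [c Ac ce] := sup_adherent e0 Abnd.
  have H2 : U [set t | x t < sup A + e].
    have [//|H] := in_ultra_setVsetC [set t | x t < sup A + e] UU.
    have : A (sup A + e) by apply: filterS H => t /= /negP; rewrite -leNgt.
    by move=> /(sup_upper_bound Abnd); rewrite gerDl leNgt e0.
  apply: filterS2 Ac H2 => t /= H3 H4; rewrite ltr_norml; lra.
move=> uM.
have [a Ha] := real (fun t => complex.Re (u t))
  (filterS (fun t H => le_trans (ler_Re (u t)) H) uM).
have [b Hb] := real (fun t => complex.Im (u t))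
  (filterS (fun t H => le_trans (ler_Im (u t)) H) uM).
have H : ucvg U u (a +i* b).
  move=> e e0; have e2 : 0 < e / 2 by rewrite divr_gt0.
  apply: filterS2 (Ha _ e2) (Hb _ e2) => t /= H1 H2.
  apply: le_lt_trans (cabs_le_ReIm _) _.
  by case: (u t) H1 H2 => /= p q; lra.
by rewrite (ulimE H).
Qed.

End ultra.

(** * A discrete Goursat theorem *)

Section goursat.
Context (R : realType).

Definition cdiff_at (F : R[i] -> R[i]) (z d : R[i]) : Prop :=
  forall e : R, 0 < e -> exists2 r : R, 0 < r & forall w, cabs (w - z) < r ->
    cabs (F w - F z - d * (w - z)) <= e * cabs (w - z).

Definition cdiff F z := exists d, cdiff_at F z d.

Context (Phi : R[i] -> R[i]).

(** Left-endpoint sums are used on both members of a pair of opposite edges.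
    This makes the contributions of an edge shared by two adjacent rectangles
    cancel exactly, and not only in the limit. *)
Definition hsum n (x y a : R) : R[i] :=
  \sum_(0 <= k < 2 ^ n) (a / 2 ^+ n)%:C * Phi ((x + k%:R * (a / 2 ^+ n)) +i* y).

Definition vsum n (x y b : R) : R[i] :=
  \sum_(0 <= k < 2 ^ n) (b / 2 ^+ n)%:C * Phi (x +i* (y + k%:R * (b / 2 ^+ n))).

(** The Riemann sum of the contour integral of Phi over the boundary of
    [x, x + a] x [y, y + b], with 2^n points on each edge. *)
Definition rect_sum n (x y a b : R) : R[i] :=
  hsum n x y a - hsum n x (y + b) a + 'i * (vsum n (x + a) y b - vsum n x y b).

Lemma hsumS n x y a :
  hsum n.+1 x y a = hsum n x y (a / 2) + hsum n (x + a / 2) y (a / 2).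
Proof.
have E : a / 2 ^+ n.+1 = a / 2 / 2 ^+ n by rewrite exprS invfM mulrA.
rewrite /hsum E expnS mul2n -addnn (big_cat_nat (n := 2 ^ n)) ?leq_addr//=.
congr (_ + _); rewrite -{1}(add0n (2 ^ n)%N) big_addn addnK.
apply: eq_bigr => k _; congr (_ * Phi (_ +i* _)).
rewrite natrD mulrDl addrA addrAC; congr (_ + _ + _).
by rewrite natrX mulrC divfK// expf_neq0// pnatr_eq0.
Qed.

Lemma vsumS n x y b :
  vsum n.+1 x y b = vsum n x y (b / 2) + vsum n x (y + b / 2) (b / 2).
Proof.
have E : b / 2 ^+ n.+1 = b / 2 / 2 ^+ n by rewrite exprS invfM mulrA.
rewrite /vsum E expnS mul2n -addnn (big_cat_nat (n := 2 ^ n)) ?leq_addr//=.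
congr (_ + _); rewrite -{1}(add0n (2 ^ n)%N) big_addn addnK.
apply: eq_bigr => k _; congr (_ * Phi (_ +i* _)).
rewrite natrD mulrDl addrA addrAC; congr (_ + _ + _).
by rewrite natrX mulrC divfK// expf_neq0// pnatr_eq0.
Qed.

Lemma rect_sumS n x y a b : rect_sum n.+1 x y a b =
  (rect_sum n x y (a / 2) (b / 2) + rect_sum n (x + a / 2) y (a / 2) (b / 2)) +
  (rect_sum n x (y + b / 2) (a / 2) (b / 2) +
   rect_sum n (x + a / 2) (y + b / 2) (a / 2) (b / 2)).
Proof.
rewrite /rect_sum !hsumS !vsumS.
have half (t : R) : t / 2 + t / 2 = t by lra.
by rewrite -!(addrA x) -!(addrA y) !half; ring.
Qed.

(** The sums of an affine function vanish exactly, since opposite edges are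
    sampled at points that differ by a fixed translation.  Only the remainder of
    the first-order expansion at p contributes. *)
Lemma rect_sum_small n x y a b (p d : R[i]) (e : R) : 0 <= a -> 0 <= b -> 0 <= e ->
  x <= complex.Re p <= x + a -> y <= complex.Im p <= y + b ->
  (forall s t, x <= s <= x + a -> y <= t <= y + b ->
    cabs (Phi (s +i* t) - Phi p - d * ((s +i* t) - p)) <= e * cabs ((s +i* t) - p)) ->
  cabs (rect_sum n x y a b) <= 2 * e * (a + b) ^+ 2.
Proof.
move=> a0 b0 e0 px py H.
pose N : R := 2 ^+ n.
have N0 : 0 < N by rewrite exprn_gt0.
have rng (k : nat) (c : R) : 0 <= c -> (k < 2 ^ n)%N -> 0 <= k%:R * (c / N) <= c.
  move=> c0 kn; rewrite mulr_ge0//=; last by rewrite divr_ge0// ltW.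
  rewrite mulrCA ler_piMr// ler_pdivrMr// mul1r /N -natrX ler_nat; exact: ltnW.
pose err s t := Phi (s +i* t) - Phi p - d * ((s +i* t) - p).
have errP s t : x <= s <= x + a -> y <= t <= y + b -> cabs (err s t) <= e * (a + b).
  move=> sx ty; apply: le_trans (H _ _ sx ty) _; rewrite ler_wpM2l//.
  apply: le_trans (cabs_le_ReIm _) _.
  by case: p px py {H err} => p q /= px py; apply: lerD; rewrite ler_norml; lra.
have sumc (c : R) : \sum_(0 <= k < 2 ^ n) (c / N)%:C = c%:C.
  rewrite sumr_const_nat subn0 -(rmorphMn (real_complex R)) /=; congr (_ %:C).
  by rewrite -mulr_natr natrX divfK ?gt_eqF.
have hE : cabs (hsum n x y a - hsum n x (y + b) a + d * 'i * (a * b)%:C)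
    <= 2 * e * (a + b) * a.
  have -> : hsum n x y a - hsum n x (y + b) a + d * 'i * (a * b)%:C =
      \sum_(0 <= k < 2 ^ n) (a / N)%:C *
        (err (x + k%:R * (a / N)) y - err (x + k%:R * (a / N)) (y + b)).
    have -> : d * 'i * (a * b)%:C = \sum_(0 <= k < 2 ^ n) (a / N)%:C * (d * 'i * b%:C).
      rewrite -mulr_suml sumc rmorphM/=; ring.
    rewrite /hsum -sumrB -big_split/=; apply: eq_bigr => k _.
    rewrite -mulrBr -mulrDr; congr (_ * _); rewrite /err.
    set s := x + _.
    have -> : s +i* (y + b) = s +i* y + 'i * b%:C.
      by simpc.
    ring.
  apply: le_trans (ler_cabs_sum _ _ _) _.
  have -> : 2 * e * (a + b) * a = \sum_(0 <= k < 2 ^ n) (a / N) * (2 * (e * (a + b))).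
    rewrite -mulr_suml sumr_const_nat subn0 -(mulr_natr _ (2 ^ n)%N) natrX divfK ?gt_eqF//; ring.
  rewrite !big_nat; apply: ler_sum => k /andP[_ kn].
  rewrite cabsM cabs_real ger0_norm; last by rewrite divr_ge0// ltW.
  apply: ler_wpM2l; first by rewrite divr_ge0// ltW.
  apply: le_trans (cabsB _ _) _; have := rng _ _ a0 kn => H1.
  rewrite mulr2n mulrDl mul1r; apply: lerD; apply: errP; lra.
have vE : cabs (vsum n (x + a) y b - vsum n x y b - d * (a * b)%:C)
    <= 2 * e * (a + b) * b.
  have -> : vsum n (x + a) y b - vsum n x y b - d * (a * b)%:C =
      \sum_(0 <= k < 2 ^ n) (b / N)%:C *
        (err (x + a) (y + k%:R * (b / N)) - err x (y + k%:R * (b / N))).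
    have -> : d * (a * b)%:C = \sum_(0 <= k < 2 ^ n) (b / N)%:C * (d * a%:C).
      rewrite -mulr_suml sumc rmorphM/=; ring.
    rewrite /vsum -!sumrB; apply: eq_bigr => k _.
    rewrite -!mulrBr; congr (_ * _); rewrite /err.
    set s := y + _.
    have -> : (x + a) +i* s = x +i* s + a%:C.
      by simpc.
    ring.
  apply: le_trans (ler_cabs_sum _ _ _) _.
  have -> : 2 * e * (a + b) * b = \sum_(0 <= k < 2 ^ n) (b / N) * (2 * (e * (a + b))).
    rewrite -mulr_suml sumr_const_nat subn0 -(mulr_natr _ (2 ^ n)%N) natrX divfK ?gt_eqF//; ring.
  rewrite !big_nat; apply: ler_sum => k /andP[_ kn].
  rewrite cabsM cabs_real ger0_norm; last by rewrite divr_ge0// ltW.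
  apply: ler_wpM2l; first by rewrite divr_ge0// ltW.
  apply: le_trans (cabsB _ _) _; have := rng _ _ b0 kn => H1.
  rewrite mulr2n mulrDl mul1r; apply: lerD; apply: errP; lra.
have -> : rect_sum n x y a b =
    (hsum n x y a - hsum n x (y + b) a + d * 'i * (a * b)%:C) +
    'i * (vsum n (x + a) y b - vsum n x y b - d * (a * b)%:C).
  rewrite /rect_sum; ring.
apply: le_trans (cabsD _ _) _; rewrite cabsM cabs_i mul1r.
have -> : 2 * e * (a + b) ^+ 2 = 2 * e * (a + b) * a + 2 * e * (a + b) * b by ring.
exact: lerD.
Qed.

Lemma nested_halves (x : nat -> R) (a : R) : 0 <= a ->
  (forall j, x j.+1 = x j \/ x j.+1 = x j + a / 2 ^+ j.+1) ->
  exists l, forall j, x j <= l <= x j + a / 2 ^+ j.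
Proof.
move=> a0 H.
have aj j : 0 <= a / 2 ^+ j by rewrite divr_ge0// exprn_ge0.
have half j : a / 2 ^+ j = a / 2 ^+ j.+1 + a / 2 ^+ j.+1.
  by rewrite exprS invfM mulrA -mulrDl; congr (_ / _); lra.
have up : {homo x : i j / (i <= j)%N >-> i <= j}.
  apply: homo_leq => //; first exact: le_trans.
  by move=> j; case: (H j) => ->//; rewrite lerDl.
have dn : {homo (fun j => x j + a / 2 ^+ j) : i j / (i <= j)%N >-> i >= j}.
  apply: homo_leq; [by []|by move=> u v w uv vw; exact: le_trans vw uv|].
  move=> j; rewrite /= (half j); have := aj j.+1; case: (H j) => ->; lra.
have ub i j : x i <= x j + a / 2 ^+ j.
  have [ij|ji] := leqP i j; first by apply: le_trans (up _ _ ij) _; rewrite lerDl.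
  by apply: le_trans (dn _ _ (ltnW ji)); rewrite lerDl.
pose X := [set x j | j in setT].
have X0 : X !=set0 by exists (x 0%N), 0%N.
exists (sup X) => j; apply/andP; split.
  by apply: ub_le_sup; [exists (x 0%N + a / 2 ^+ 0) => _ [i _ <-]|exists j].
by apply: ge_sup => // _ [i _ <-].
Qed.

(** If the sums on a rectangle exceed c infinitely often, those on one of its
    quarters exceed c/4 infinitely often.  Iterating yields nested rectangles
    that shrink to a point, where differentiability makes the sums smaller than
    the share of c that is left. *)
Lemma goursat (x0 y0 a b : R) : 0 <= a -> 0 <= b ->
  (forall s t, x0 <= s <= x0 + a -> y0 <= t <= y0 + b -> cdiff Phi (s +i* t)) ->
  forall c, 0 < c -> exists n0, forall n, (n0 <= n)%N -> cabs (rect_sum n x0 y0 a b) <= c.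
Proof.
move=> a0 b0 dPhi c c0; apply: contrapT => nE.
pose bad j (p : R * R) := forall n0, exists2 n, (n0 <= n)%N &
  c / 4 ^+ j < cabs (rect_sum n p.1 p.2 (a / 2 ^+ j) (b / 2 ^+ j)).
have bad0 : bad 0%N (x0, y0).
  move=> n0; apply: contrapT => H; apply: nE; exists n0 => n n0n.
  rewrite leNgt; apply/negP => H'; apply: H; exists n => //=.
  by rewrite !expr0 !divr1.
pose child j (p q : R * R) :=
  (q.1 = p.1 \/ q.1 = p.1 + a / 2 ^+ j.+1) /\ (q.2 = p.2 \/ q.2 = p.2 + b / 2 ^+ j.+1).
have badS j p : bad j p -> exists q, bad j.+1 q /\ child j p q.
  move=> bjp; apply: contrapT => nq.
  have good q : child j p q -> exists n0, forall n, (n0 <= n)%N ->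
      cabs (rect_sum n q.1 q.2 (a / 2 ^+ j.+1) (b / 2 ^+ j.+1)) <= c / 4 ^+ j.+1.
    move=> pq; apply: contrapT => H; apply: nq; exists q; split => // n0.
    apply: contrapT => H'; apply: H; exists n0 => n n0n; rewrite leNgt.
    by apply/negP => H''; apply: H'; exists n.
  have [n1 H1] := good (p.1, p.2) (conj (or_introl erefl) (or_introl erefl)).
  have [n2 H2] := good (_, p.2) (conj (or_intror erefl) (or_introl erefl)).
  have [n3 H3] := good (p.1, _) (conj (or_introl erefl) (or_intror erefl)).
  have [n4 H4] := good (_, _) (conj (or_intror erefl) (or_intror erefl)).
  have [[//|n]] := bjp (n1 + n2 + n3 + n4).+1; rewrite ltnS => nn.
  have half (t : R) : t / 2 ^+ j / 2 = t / 2 ^+ j.+1 by rewrite exprSr invfM mulrA.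
  rewrite rect_sumS !half ltNge => /negP; apply.
  have -> : c / 4 ^+ j = (c / 4 ^+ j.+1 + c / 4 ^+ j.+1) + (c / 4 ^+ j.+1 + c / 4 ^+ j.+1).
    rewrite exprSr invfM mulrA; lra.
  apply: le_trans (cabsD _ _) (lerD _ _);
    apply: le_trans (cabsD _ _) (lerD _ _); [apply: H1|apply: H2|apply: H3|apply: H4];
    apply: leq_trans nn; rewrite -?addnA ?leq_addr//.
  - by rewrite addnCA leq_addr.
  - by rewrite addnA addnCA leq_addr.
  - by rewrite !addnA leq_addl.
pose nxt j p := xget p [set q | bad j.+1 q /\ child j p q].
pose p_ := fix p_ j := if j is i.+1 then nxt i (p_ i) else (x0, y0).
have badp j : bad j (p_ j).
  elim: j => [//|j IH] /=.
  by have [] := @xgetPex _ (p_ j) [set q | bad j.+1 q /\ child j (p_ j) q] (badS _ _ IH).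
have childp j : child j (p_ j) (p_ j.+1).
  have [] // := @xgetPex _ (p_ j) [set q | bad j.+1 q /\ child j (p_ j) q] (badS _ _ (badp j)).
have [x Hx] := nested_halves a0 (fun j => (childp j).1).
have [y Hy] := nested_halves b0 (fun j => (childp j).2).
have /= := Hx 0%N; have /= := Hy 0%N; rewrite !expr0 !divr1 => Hy0 Hx0.
have [d Hd] := dPhi x y Hx0 Hy0.
(* With e = c / M, the bound 2 e (a + b)^2 / 4^j of [rect_sum_small] on the j-th
   rectangle is at most c / 4^j. *)
pose M := 2 * (a + b) ^+ 2 + 1.
have M0 : 0 < M by rewrite ltr_wpDl// mulr_ge0// sqr_ge0.
have e0 : 0 < c / M by rewrite divr_gt0.
have [r r0 Hr] := Hd _ e0.
have [j Hj] : exists j, (a + b) / 2 ^+ j < r.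
  have [j _ Hj] := near_infty_natSinv_expn_lt (PosNum (divr_gt0 r0 (ltr_wpDl (addr_ge0 a0 b0) ltr01))).
  exists j; have := Hj j (leqnn j); rewrite /= ltr_pdivlMr; last by rewrite ltr_wpDl// addr_ge0.
  apply: le_lt_trans; rewrite mul1r mulrC ler_wpM2l ?invr_ge0 ?exprn_ge0//; lra.
have aj : 0 <= a / 2 ^+ j by rewrite divr_ge0// exprn_ge0.
have bj : 0 <= b / 2 ^+ j by rewrite divr_ge0// exprn_ge0.
have [n _] := badp j 0%N; rewrite ltNge => /negP; apply.
apply: le_trans (@rect_sum_small n _ _ _ _ (x +i* y) d (c / M) aj bj (ltW e0) (Hx j) (Hy j) _) _.
  move=> s t Hs Ht; apply: Hr; apply: le_lt_trans (cabs_le_ReIm _) _.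
  apply: le_lt_trans Hj; rewrite mulrDl; have := Hx j; have := Hy j => /=.
  by move=> H1 H2; apply: lerD; rewrite ler_norml; lra.
rewrite -mulrDl expr_div_n -exprM mulnC exprM.
have -> : (2 : R) ^+ 2 = 4 by rewrite expr2; lra.
rewrite mulrA ler_wpM2r ?invr_ge0 ?exprn_ge0//.
have -> : 2 * (c / M) * (a + b) ^+ 2 = c * (2 * (a + b) ^+ 2 / M) by ring.
rewrite ler_piMr ?(ltW c0)// ler_pdivrMr// /M; lra.
Qed.

End goursat.

(** * Complex differentiability and the exponential *)

(** The epsilon-delta form of differentiability holds at h = 0 as well, unlike
    the difference quotient, and is preferred below. *)
Lemma is_derive_eps (K : numFieldType) (f : K -> K) (z d : K) :
  is_derive z 1 f d -> forall e : K, 0 < e -> exists2 r : K, 0 < r &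
    forall h, `|h| < r -> `|f (z + h) - f z - d * h| <= e * `|h|.
Proof.
move=> [dfz <-] e e0.
have /cvgrPdist_le /(_ _ e0) := dfz.
rewrite -/('D_1 f z) => -[r /= r0 H]; exists r => // h hr.
have [->|h0] := eqVneq h 0; first by rewrite addr0 !subrr mulr0 subr0 !normr0 mulr0.
have := H h; rewrite /= sub0r normrN => /(_ hr h0).
rewrite distrC => H'.
have -> : f (z + h) - f z - 'D_1 f z * h =
    h * (h^-1 *: (f (h *: 1 + z) - f z) - 'D_1 f z).
  rewrite mulrBr [h * (_ *: _)]mulrA mulfV// mul1r [h *: 1]mulr1 (addrC h).
  by rewrite (mulrC h).
by rewrite normrM [leRHS]mulrC ler_wpM2l.
Qed.

Lemma derivable_eps (K : numFieldType) (f : K -> K) (z d : K) :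
  (forall e : K, 0 < e -> exists2 r : K, 0 < r &
    forall h, `|h| < r -> `|f (z + h) - f z - d * h| <= e * `|h|) ->
  derivable f z 1.
Proof.
move=> H; apply/cvg_ex; exists d; apply/cvgrPdist_le => e e0.
have [r r0 Hr] := H _ e0; exists r => //= h; rewrite /= sub0r normrN => hr h0.
rewrite distrC.
have -> : h^-1 *: (f (h *: 1 + z) - f z) - d = h^-1 * (f (z + h) - f z - d * h).
  rewrite mulrBr [h *: 1]mulr1 (addrC h) [d * h]mulrC [h^-1 * (h * d)]mulrA.
  by rewrite mulVf// mul1r.
by rewrite normrM normfV ler_pdivrMl ?normr_gt0// [leRHS]mulrC; apply: Hr.
Qed.

Section cexp.
Context (R : realType).
Implicit Types z w : R[i].

Lemma gt0_complexE (e : R[i]) : 0 < e -> exists2 r : R, 0 < r & e = r%:C.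
Proof.
move=> e0; have eE := cabsE e; rewrite gtr0_norm// in eE.
by exists (cabs e) => //; rewrite cabs_gt0 gt_eqF.
Qed.

Lemma cdiff_derivable (F : R[i] -> R[i]) z : cdiff F z <-> derivable F z 1.
Proof.
split=> [[d Hd]|dF].
  apply: (@derivable_eps _ F z d) => e /gt0_complexE[r r0 ->].
  have [s s0 Hs] := Hd _ r0; exists s%:C; first by rewrite ltcR.
  move=> h; rewrite !cabsE ltcR => hs.
  have := Hs (z + h); rewrite (addrC z) addrK => /(_ hs).
  by rewrite -lecR rmorphM.
have := is_derive_eps (derivableP dF); set d := 'D_1 F z => H; exists d => e e0.
have [|s /gt0_complexE[r r0 ->] Hr] := H e%:C; first by rewrite ltcR.
exists r => // w wr; have := Hr (w - z); rewrite !cabsE ltcR => /(_ wr).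
by rewrite subrKC -rmorphM /= lecR.
Qed.

Definition cexp z : R[i] :=
  (expR (complex.Re z) * cos (complex.Im z)) +i* (expR (complex.Re z) * sin (complex.Im z)).

Lemma cexpD z w : cexp (z + w) = cexp z * cexp w.
Proof.
case: z w => [a b] [c d]; rewrite /cexp /= expRD cosD sinD; simpc.
by congr (_ +i* _); ring.
Qed.

Lemma cabs_cexp z : cabs (cexp z) = expR (complex.Re z).
Proof.
apply/eqP; rewrite -(eqrXn2 (n := 2)) ?cabs_ge0 ?expR_ge0// cabs_sqr /=.
by rewrite !exprMn -mulrDr cos2Dsin2 mulr1.
Qed.

(** By cexp (z + h) = cexp z * cexp h it suffices to treat z = 0, where the
    real derivatives of exp, cos and sin at 0 give the first-order expansion of
    both components. *)
Lemma cdiff_at_cexp z : cdiff_at cexp z (cexp z).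
Proof.
suff H0 (e : R) : 0 < e -> exists2 r : R, 0 < r & forall h, cabs h < r ->
    cabs (cexp h - 1 - h) <= e * cabs h.
  move=> e e0; have [|r r0 Hr] := H0 (e / expR (complex.Re z)).
    by rewrite divr_gt0// expR_gt0.
  exists r => // w /Hr.
  rewrite mulrAC ler_pdivlMr ?expR_gt0// mulrC -(cabs_cexp z) -cabsM.
  by rewrite 2!mulrBr mulr1 -cexpD subrKC.
move=> e0.
(* The two components together consist of four error terms, which amount to
   9 e1 |h| at most. *)
have [e1 [e10 e11 e1e]] : exists e1 : R, [/\ 0 < e1, e1 <= 1 & e1 <= e / 10].
  exists (Num.min (e / 10) 1).
  by rewrite lt_min ltr01 andbT divr_gt0// ge_min lexx orbT ge_min lexx.
have [r1 r10 H1] := is_derive_eps (is_derive_expR (0 : R)) e10.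
have [r2 r20 H2] := is_derive_eps (is_derive_cos (0 : R)) e10.
have [r3 r30 H3] := is_derive_eps (is_derive_sin (0 : R)) e10.
pose r := Num.min (Num.min r1 r2) (Num.min r3 e1).
exists r; first by rewrite !lt_min r10 r20 r30 e10.
move=> h hr; have : cabs h < r1 /\ cabs h < r2 /\ cabs h < r3 /\ cabs h < e1.
  by move: hr; rewrite !lt_min => /andP[/andP[-> ->] /andP[-> ->]].
move=> [hr1 [hr2 [hr3 he1]]].
have ha := ler_Re h; have hb := ler_Im h; have h0 := cabs_ge0 h.
case: h h0 ha hb hr hr1 hr2 hr3 he1 => a b h0 /= ha hb _ hr1 hr2 hr3 he1.
have {}H1 := H1 a (le_lt_trans ha hr1).
have {}H2 := H2 b (le_lt_trans hb hr2).
have {}H3 := H3 b (le_lt_trans hb hr3).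
move: H1 H2 H3; rewrite !add0r expR0 cos0 sin0 oppr0 mul0r !subr0 !mul1r ?addr0 => H1 H2 H3.
set m := cabs (a +i* b) in h0 ha hb hr1 hr2 hr3 he1 *.
have K1 : `|expR a - 1 - a| <= e1 * m by apply: le_trans H1 _; rewrite ler_wpM2l// ltW.
have K2 : `|cos b - 1| <= e1 * m by apply: le_trans H2 _; rewrite ler_wpM2l// ltW.
have K3 : `|sin b - b| <= e1 * m by apply: le_trans H3 _; rewrite ler_wpM2l// ltW.
have e1m : e1 * m <= m by rewrite ler_piMl.
have K4 : `|expR a - 1| <= 2 * m.
  by move: K1 ha; rewrite !ler_norml; lra.
have K5 : `|expR a| <= 3.
  by move: K4; rewrite !ler_norml; lra.
apply: le_trans (cabs_le_ReIm _) _; rewrite /cexp /=.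
have -> : expR a * cos b - 1 - a = (expR a - 1 - a) + expR a * (cos b - 1) by ring.
have -> : expR a * sin b - 0 - b = expR a * (sin b - b) + (expR a - 1) * b by ring.
have K6 : `|expR a * (cos b - 1)| <= 3 * (e1 * m) by rewrite normrM ler_pM.
have K7 : `|expR a * (sin b - b)| <= 3 * (e1 * m) by rewrite normrM ler_pM.
have K8 : `|(expR a - 1) * b| <= 2 * (e1 * m).
  rewrite normrM; apply: (@le_trans _ _ (2 * m * m)); first by rewrite ler_pM.
  by rewrite -mulrA ler_wpM2l// ler_wpM2r// ltW.
have := ler_normD (expR a - 1 - a) (expR a * (cos b - 1)).
have := ler_normD (expR a * (sin b - b)) ((expR a - 1) * b).
have : e1 * m <= e / 10 * m by rewrite ler_wpM2r.
have : 0 <= e * m by rewrite mulr_ge0// ltW.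
have -> : e / 10 * m = e * m / 10 by ring.
lra.
Qed.

Lemma cexp_2pi z : cexp (z + 0 +i* (2 * pi)) = cexp z.
Proof.
rewrite cexpD /cexp /= expR0 !mul1r.
rewrite (_ : 2 * pi = pi *+ 2 :> R); last by rewrite mulr_natl.
by rewrite cos2pi sin2pi [1 +i* 0](_ : _ = 1)// mulr1.
Qed.

End cexp.

(** * Rules of differentiation *)

Section cdiff.
Context (R : realType).
Implicit Types (F G : R[i] -> R[i]) (z w : R[i]).

Lemma cdiff_cst c z : cdiff (fun=> c) z.
Proof. by apply/cdiff_derivable; exact: derivable_cst. Qed.

Lemma cdiff_id z : cdiff id z.
Proof. by apply/cdiff_derivable; exact: derivable_id. Qed.

Lemma cdiffD F G z : cdiff F z -> cdiff G z -> cdiff (fun w => F w + G w) z.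
Proof.
by move=> /cdiff_derivable dF /cdiff_derivable dG; apply/cdiff_derivable/derivableD.
Qed.

Lemma cdiffM F G z : cdiff F z -> cdiff G z -> cdiff (fun w => F w * G w) z.
Proof.
move=> /cdiff_derivable dF /cdiff_derivable dG; apply/cdiff_derivable.
by rewrite -[fun w => _]/(F * G); apply: derivableM; [exact: dF|exact: dG].
Qed.

Lemma cdiffX F z n : cdiff F z -> cdiff (fun w => F w ^+ n) z.
Proof.
move=> dF; elim: n => [|n IH]; first exact: cdiff_cst.
rewrite (_ : (fun w => _) = (fun w => F w * F w ^+ n)); first exact: cdiffM.
by apply/funext => w; rewrite exprS.
Qed.

Lemma cdiffV F z : F z != 0 -> cdiff F z -> cdiff (fun w => (F w)^-1) z.
Proof.
move=> F0 /cdiff_derivable dF; apply/cdiff_derivable.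
by apply: derivableV; [exact: F0|exact: dF].
Qed.

Lemma cdiff_horner (p : {poly R[i]}) z : cdiff (fun w => p.[w]) z.
Proof.
elim/poly_ind: p => [|p c IH].
  by rewrite (_ : (fun w => _) = cst 0); [exact: cdiff_cst|apply/funext => w; rewrite horner0].
rewrite (_ : (fun w => _) = (fun w => p.[w] * w + c)).
  by apply: cdiffD; [apply: cdiffM => //; exact: cdiff_id|exact: cdiff_cst].
by apply/funext => w; rewrite hornerMXaddC.
Qed.

Lemma cdiff_ext F G z (r : R) : 0 < r -> (forall w, cabs (w - z) < r -> F w = G w) ->
  cdiff F z -> cdiff G z.
Proof.
move=> r0 FG [d Hd]; exists d => e e0; have [s s0 Hs] := Hd _ e0.
exists (Num.min r s); first by rewrite lt_min r0.
move=> w; rewrite lt_min => /andP[wr ws]; rewrite -(FG _ wr) -FG ?subrr ?cabs0//.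
exact: Hs.
Qed.

Lemma cdiff_continuous F z : cdiff F z -> forall e : R, 0 < e ->
  exists2 r, 0 < r & forall w, cabs (w - z) < r -> cabs (F w - F z) < e.
Proof.
move=> [d Hd] e e0; have [r r0 Hr] := Hd 1 ltr01.
have d0 := cabs_ge0 d.
have k0 : 0 < cabs d + 1 by rewrite ltr_wpDl.
exists (Num.min r (e / (cabs d + 1))); first by rewrite lt_min r0 divr_gt0.
move=> w; rewrite lt_min => /andP[/Hr wr]; rewrite ltr_pdivlMr// => we.
apply: le_lt_trans we.
rewrite mulrDr mulr1 mulrC -cabsM -[F w - F z](subrK (d * (w - z))) addrC.
by apply: le_trans (cabsD _ _) _; rewrite lerD2l; move: wr; rewrite mul1r.
Qed.

Lemma cdiff_comp F G z : cdiff G z -> cdiff F (G z) -> cdiff (fun w => F (G w)) z.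
Proof.
move=> dG [b Hb]; have [a Ha] := dG; exists (b * a) => e e0.
have a0 := cabs_ge0 a; have b0 := cabs_ge0 b.
have A0 : 0 < cabs a + 1 by rewrite ltr_wpDl.
have B0 : 0 < 2 * (cabs b + 1) by rewrite mulr_gt0// ltr_wpDl.
have [r r0 Hr] := Hb _ (divr_gt0 e0 (mulr_gt0 (ltr0Sn _ 1) A0)).
have [s s0 Hs] := cdiff_continuous dG r0.
have [t t0 Ht] := Ha _ (divr_gt0 e0 B0).
have [u u0 Hu] := Ha _ ltr01.
exists (Num.min s (Num.min t u)); first by rewrite !lt_min s0 t0.
move=> w; rewrite !lt_min => /and3P[/Hs /Hr H1 /Ht H2 /Hu H3].
set m := cabs (w - z) in H1 H2 H3 *.
have m0 : 0 <= m by exact: cabs_ge0.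
have -> : F (G w) - F (G z) - b * a * (w - z) =
  (F (G w) - F (G z) - b * (G w - G z)) + b * (G w - G z - a * (w - z)) by ring.
apply: le_trans (cabsD _ _) _; rewrite cabsM.
have H4 : cabs (G w - G z) <= (cabs a + 1) * m.
  rewrite -[G w - G z](subrK (a * (w - z))) addrC; apply: le_trans (cabsD _ _) _.
  by rewrite mulrDl mul1r cabsM lerD2l; move: H3; rewrite mul1r.
have H5 : e / (2 * (cabs a + 1)) * cabs (G w - G z) <= e / 2 * m.
  have -> : e / 2 * m = e / (2 * (cabs a + 1)) * ((cabs a + 1) * m).
    by field; rewrite gt_eqF.
  by rewrite ler_wpM2l// divr_ge0 ?(ltW e0)// mulr_ge0// ltW.
have H6 : cabs b * cabs (G w - G z - a * (w - z)) <= e / 2 * m.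
  have -> : e / 2 * m = (cabs b + 1) * (e / (2 * (cabs b + 1)) * m).
    by field; rewrite gt_eqF// ltr_wpDl.
  by apply: ler_pM => //; [exact: cabs_ge0|rewrite lerDl].
have -> : e * m = e / 2 * m + e / 2 * m by field.
by apply: lerD => //; apply: le_trans H5.
Qed.

End cdiff.

(** * The maximum modulus principle *)

Section maximum_modulus.
Context (R : realType).
Implicit Types (F : R[i] -> R[i]) (z w : R[i]).

(** In the coordinate cexp, a rectangle of height 2 pi has equal contributions
    from its horizontal edges, so Goursat's theorem says that the averages of F
    over the circles of radius 1 and exp (- S) are arbitrarily close.  The
    former is at most M and, for S large, the latter is close to F 0. *)
Lemma max_modulus_center F (M : R) :
  (forall z, cabs z <= 1 -> cdiff F z) ->
  (forall z, cabs z = 1 -> cabs (F z) <= M) -> cabs (F 0) <= M.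
Proof.
move=> dF FM; apply/ler_addgt0Pr => e0 e00.
pose e := e0 / 2; have e_gt0 : 0 < e by rewrite divr_gt0.
have pi2 : 0 < 2 * pi :> R by rewrite mulr_gt0// pi_gt0.
have [r r0 Hr] := cdiff_continuous (dF 0 (eq_ind_r (fun x => x <= 1) ler01 (cabs0 R))) e_gt0.
(* S is so large that the circle of radius exp (- S) lies in the disc of radius
   r, where F is within e of F 0. *)
pose S := `|ln r| + 1.
have S0 : 0 <= S by rewrite addr_ge0.
have Sr : expR (- S) < r.
  rewrite -[ltRHS](lnK r0) ltr_expR /S.
  by have := ler_norm (- ln r); rewrite normrN; lra.
pose Phi z := F (cexp z).
have cexp1 (s t : R) : - S <= s <= - S + S -> cabs (cexp (s +i* t)) <= 1.
  by move=> Hs; rewrite cabs_cexp /= -expR0 ler_expR; lra.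
have dPhi s t : - S <= s <= - S + S -> 0 <= t <= 0 + 2 * pi -> cdiff Phi (s +i* t).
  move=> Hs _; apply: cdiff_comp; last exact/dF/cexp1.
  by exists (cexp (s +i* t)); exact: cdiff_at_cexp.
have [n Hn] := goursat S0 (ltW pi2) dPhi (mulr_gt0 pi2 e_gt0).
have := Hn n (leqnn n); rewrite /rect_sum addNr.
have -> : hsum Phi n (- S) (0 + 2 * pi) S = hsum Phi n (- S) 0 S.
  apply: eq_bigr => k _; congr (_ * _); rewrite /Phi -[RHS]/(F (cexp _)) -[in RHS]cexp_2pi.
  by congr (F (cexp _)); simpc; rewrite ?add0r ?addr0.
rewrite subrr add0r cabsM cabs_i mul1r => H.
pose c : R := 2 * pi / 2 ^+ n.
have c0 : 0 <= c by rewrite divr_ge0 ?(ltW pi2)// exprn_ge0.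
have sumc (t : R) : \sum_(0 <= k < 2 ^ n) (c * t) = 2 * pi * t.
  rewrite -mulr_suml sumr_const_nat subn0 -(mulr_natr _ (2 ^ n)%N) natrX /c divfK//.
have H1 : cabs (vsum Phi n 0 0 (2 * pi)) <= 2 * pi * M.
  rewrite -(sumc M); apply: le_trans (ler_cabs_sum _ _ _) _; apply: ler_sum => k _.
  rewrite cabsM cabs_real ger0_norm// ler_wpM2l// FM// cabs_cexp /=.
  by rewrite expR0.
have H2 : cabs (vsum Phi n (- S) 0 (2 * pi) - (2 * pi)%:C * F 0) <= 2 * pi * e.
  have -> : (2 * pi)%:C * F 0 = \sum_(0 <= k < 2 ^ n) c%:C * F 0.
    rewrite -mulr_suml; congr (_ * _).
    rewrite -[LHS](_ : (\sum_(0 <= k < 2 ^ n) c)%:C = _); first by rewrite rmorph_sum.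
    by congr (_ %:C); rewrite -[RHS]mulr1 -sumc; apply: eq_bigr => k _; rewrite mulr1.
  rewrite -(sumc e) /vsum -sumrB; apply: le_trans (ler_cabs_sum _ _ _) _.
  apply: ler_sum => k _; rewrite -mulrBr cabsM cabs_real ger0_norm// ler_wpM2l//.
  by apply/ltW/Hr; rewrite subr0 cabs_cexp.
have H3 : 2 * pi * cabs (F 0) <= 2 * pi * (M + e0).
  have -> : 2 * pi * cabs (F 0) = cabs ((2 * pi)%:C * F 0).
    by rewrite cabsM cabs_real gtr0_norm.
  set V := vsum Phi n 0 0 _ in H H1; set V' := vsum _ _ _ _ _ in H H2.
  have -> : (2 * pi)%:C * F 0 = V - (V - V') - (V' - (2 * pi)%:C * F 0) by ring.
  apply: le_trans (cabsB _ _) _; apply: le_trans (lerD (cabsB _ _) (lexx _)) _.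
  have -> : 2 * pi * (M + e0) = 2 * pi * M + 2 * pi * e + 2 * pi * e.
    by rewrite /e; field.
  by apply: lerD => //; exact: lerD.
by rewrite -(ler_pM2l pi2).
Qed.

(** The difference of the squares is (1 - |a|^2) (1 - |z|^2). *)
Lemma moebius_le (a z : R[i]) : cabs a <= 1 -> cabs z <= 1 ->
  cabs (z + a) <= cabs (1 + a^* * z).
Proof.
move=> a1 z1; rewrite -(ler_pXn2r (n:=2)) ?nnegrE ?cabs_ge0// -subr_ge0.
have -> : cabs (1 + a^* * z) ^+ 2 - cabs (z + a) ^+ 2 =
    (1 - cabs a ^+ 2) * (1 - cabs z ^+ 2).
  by rewrite !cabs_sqr; case: a {a1} => s t; case: z {z1} => p q /=; ring.
by rewrite mulr_ge0// subr_ge0 expr_le1// cabs_ge0.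
Qed.

Lemma moebius_eq (a z : R[i]) : cabs z = 1 -> cabs (z + a) = cabs (1 + a^* * z).
Proof.
move=> z1; apply/eqP; rewrite -(eqrXn2 (n:=2)) ?cabs_ge0// -subr_eq0; apply/eqP.
have -> : cabs (z + a) ^+ 2 - cabs (1 + a^* * z) ^+ 2 =
    - (1 - cabs a ^+ 2) * (1 - cabs z ^+ 2).
  by rewrite !cabs_sqr; case: a => s t; case: z {z1} => p q /=; ring.
by rewrite z1 expr1n subrr mulr0.
Qed.

(** The Moebius map m sends 0 to z and preserves the disc of radius r (rescaled
    to the unit disc) and its boundary, which reduces the claim to the centre. *)
Theorem max_modulus F (r M : R) : 0 < r ->
  (forall z, cabs z <= r -> cdiff F z) ->
  (forall z, cabs z = r -> cabs (F z) <= M) ->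
  forall z, cabs z <= r -> cabs (F z) <= M.
Proof.
move=> r0 dF FM z; rewrite le_eqVlt => /predU1P[/FM//|zr].
pose a := z / r%:C.
have rC0 : r%:C != 0 :> R[i] by rewrite -cabs_gt0 cabs_real gtr0_norm.
have a1 : cabs a < 1.
  by rewrite cabsM cabsV cabs_real gtr0_norm// ltr_pdivrMr// mul1r.
pose m w := r%:C * (w + a) / (1 + a^* * w).
have den w : cabs w <= 1 -> 0 < cabs (1 + a^* * w).
  move=> w1; have := cabsD (1 + a^* * w) (- (a^* * w)).
  rewrite addrK cabs1 cabsN cabsM cabs_conj.
  have : cabs a * cabs w <= cabs a by rewrite ler_piMr// cabs_ge0.
  lra.
have mE w : cabs (m w) = r * (cabs (w + a) / cabs (1 + a^* * w)).
  by rewrite /m !cabsM cabsV cabs_real gtr0_norm// mulrA.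
have m1 w : cabs w <= 1 -> cabs (m w) <= r.
  move=> w1; rewrite mE ler_piMr ?(ltW r0)// ler_pdivrMr ?den// mul1r.
  by apply: moebius_le => //; exact: ltW.
have dm w : cabs w <= 1 -> cdiff m w.
  move=> w1; apply: cdiffM.
    apply: cdiffM; first exact: cdiff_cst.
    by apply: cdiffD; [exact: cdiff_id|exact: cdiff_cst].
  apply: cdiffV; first by rewrite -cabs_gt0 den.
  apply: cdiffD; first exact: cdiff_cst.
  by apply: cdiffM; [exact: cdiff_cst|exact: cdiff_id].
have <- : m 0 = z.
  by rewrite /m add0r mulr0 addr0 divr1 mulrC divfK.
apply: (max_modulus_center (F := fun w => F (m w))).
  by move=> w w1; apply: cdiff_comp; [exact: dm|apply: dF; exact: m1].
move=> w w1; apply: FM; rewrite mE moebius_eq// divff ?mulr1//.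
by rewrite gt_eqF// den// w1.
Qed.

End maximum_modulus.

(** * Polynomials with prescribed modulus on a circle *)

Section weierstrass.
Context (R : realType).

Lemma prim_root_exists n : (0 < n)%N -> exists w : R[i], n.-primitive_root w.
Proof.
pose p : {poly R[i]} := 'X^n - 1; have [r Dp] := closed_field_poly_normal p.
move=> n_gt0; rewrite (monicP _) ?monicXnsubC // scale1r in Dp.
have rn1: all n.-unity_root r by apply/allP=> z; rewrite -root_prod_XsubC -Dp.
have sz_r: (n < (size r).+1)%N.
  by rewrite -(size_prod_XsubC r id) -Dp size_XnsubC.
have [|z] := hasP (has_prim_root n_gt0 rn1 _ sz_r); last by exists z.
by rewrite -separable_prod_XsubC -Dp separable_Xn_sub_1 // pnatr_eq0 -lt0n.
Qed.

Lemma sum_prim_root N (w : R[i]) m : (0 < N)%N -> N.-primitive_root w ->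
  \sum_(k < N) w ^+ (k * m) = if (N %| m)%N then N%:R else 0.
Proof.
move=> N0 wN; rewrite (prim_order_dvd wN).
have -> : \sum_(k < N) w ^+ (k * m) = \sum_(k < N) (w ^+ m) ^+ k.
  by apply: eq_bigr => k _; rewrite mulnC exprM.
case: eqVneq => [->|w1].
  by under eq_bigr do rewrite expr1n; rewrite sumr_const card_ord.
have := subrX1 (w ^+ m) N; rewrite -exprM mulnC exprM (prim_expr_order wN) expr1n subrr.
by move/esym/eqP; rewrite mulf_eq0 subr_eq0 (negbTE w1) => /eqP.
Qed.

(** After expansion, the sum over the roots of unity retains only the powers
    z^i with n + 1 dividing i + 1; as i <= 2 n, this means i = n.  The sum is a
    discrete convolution of the constant 1 with a Fejer-type kernel. *)
Lemma central_binomial_sum n (w z : R[i]) : n.+1.-primitive_root w ->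
  \sum_(k < n.+1) w ^+ k * (1 + z * w ^+ k) ^+ (2 * n) =
    (n.+1 * 'C(2 * n, n))%:R * z ^+ n.
Proof.
move=> wn.
have -> : \sum_(k < n.+1) w ^+ k * (1 + z * w ^+ k) ^+ (2 * n) =
    \sum_(i < (2 * n).+1) (z ^+ i *+ 'C(2 * n, i)) * \sum_(k < n.+1) w ^+ (k * i.+1).
  under [RHS]eq_bigr do rewrite mulr_sumr.
  rewrite [RHS]exchange_big /=; apply: eq_bigr => k _.
  rewrite exprDn mulr_sumr; apply: eq_bigr => i _.
  by rewrite expr1n mul1r exprMn -exprM mulnS exprD -mulrnAl; ring.
have ni : (n < (2 * n).+1)%N by rewrite ltnS mul2n -addnn leq_addr.
rewrite (bigD1 (Ordinal ni)) //= sum_prim_root// dvdnn big1 ?addr0 => [|i ni'].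
  by rewrite natrM -mulr_natr; ring.
rewrite sum_prim_root// ifN ?mulr0//; apply: contra ni'.
move=> /dvdnP[q E]; apply/eqP/val_inj => /=.
have := ltn_ord i; case: q E => [//|[|q]]; first by rewrite mul1n => -[].
move=> E ilt; have : (2 * n.+1 <= q.+2 * n.+1)%N by rewrite leq_mul2r.
by rewrite -E => ?; lia.
Qed.

(** For v on the unit circle, |1 + v|^2 = (1 + v)^2 / v, so the modulus of each
    term of [central_binomial_sum] is that term times z^(-n), the same unimodular
    factor for all of them. *)
Lemma kernel_sum n (w z : R[i]) : n.+1.-primitive_root w -> cabs z = 1 ->
  \sum_(k < n.+1) cabs (1 + z * w ^+ k) ^+ (2 * n) = (n.+1 * 'C(2 * n, n))%:R.
Proof.
move=> wn z1.
have z0 : z ^+ n != 0 by rewrite -cabs_eq0 cabsX z1 expr1n oner_neq0.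
apply: (@complexI R); apply: (mulIf z0).
rewrite (rmorph_nat (real_complex R)) -(central_binomial_sum _ wn) rmorph_sum mulr_suml.
apply: eq_bigr => k _; set v := z * w ^+ k.
have wk1 : (w ^+ k) ^+ n.+1 = 1 by rewrite -exprM mulnC exprM (prim_expr_order wn) expr1n.
have v1 : cabs v = 1.
  rewrite cabsM z1 mul1r; apply/eqP; rewrite -(@pexpr_eq1 _ _ n.+1) ?cabs_ge0//.
  by rewrite -cabsX wk1 cabs1.
have vv : v * v^* = 1 by rewrite -cabs_sqrC v1 expr1n.
rewrite exprM rmorphXn /= cabs_sqrC rmorphD rmorph1.
have -> : z ^+ n = w ^+ k * v ^+ n by rewrite exprMn mulrCA -exprS wk1 mulr1.
rewrite mulrCA; congr (_ * _); rewrite -exprMn exprM; congr (_ ^+ _).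
have -> : (1 + v) * (1 + v^*) * v = (1 + v) * (v + v * v^*) by ring.
rewrite vv; ring.
Qed.

(** The mass of the kernel is at least its maximum 4^n up to a factor that is
    polynomial in n, so that exponentially small tails are negligible. *)
Lemma expn4_le_bin n : (4 ^ n <= (2 * n).+1 * 'C(2 * n, n))%N.
Proof.
elim: n => [//|n IH].
have H : (n.+1 * 'C(2 * n.+1, n.+1) = 2 * (2 * n).+1 * 'C(2 * n, n))%N.
  have -> : (2 * n.+1 = (2 * n).+2)%N by lia.
  have := mul_bin_diag (2 * n).+2 n; rewrite /= => <-.
  have := mul_bin_down (2 * n).+1 n; rewrite /=.
  have -> : ((2 * n).+1 - n = n.+1)%N by lia.
  by move=> H; apply/eqP; rewrite -(eqn_pmul2l (ltn0Sn n)); apply/eqP; nia.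
rewrite expnS -(leq_pmul2l (ltn0Sn n)) mulnCA [leqRHS]mulnCA H.
nia.
Qed.

Lemma geometric_decay (t e : R) : 0 < t <= 1 -> 0 < e ->
  exists n, (2 * n).+1%:R * ((1 - t) ^+ n) ^+ 2 <= e.
Proof.
move=> /andP[t0 t1] e0; set s := 1 - t.
have s0 : 0 <= s by rewrite /s; lra.
have s1 : 0 <= s * (1 + t) <= 1 by rewrite /s; apply/andP; split; nra.
have bern n : s ^+ n * (1 + n%:R * t) <= 1.
  have : (1 + n%:R * t) <= (1 + t) ^+ n.
    elim: n => [|n IH]; first by rewrite expr0 mul0r addr0.
    rewrite exprS -natr1; have : 0 <= n%:R :> R by []. 
    move: IH; set a := (1 + t) ^+ n; set m := n%:R; nra.
  move=> H; apply: le_trans (ler_wpM2l (exprn_ge0 n s0) H) _.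
  by rewrite -exprMn exprn_ile1; case/andP: s1.
pose n := Num.bound (2 / t / t / e); exists n.
have := archi_boundP (ltW (divr_gt0 (divr_gt0 (divr_gt0 (ltr0Sn R 1) t0) t0) e0)).
rewrite -/n ltr_pdivrMr// ltr_pdivrMr// ltr_pdivrMr// => Hn.
have := bern n; have := exprn_ge0 n s0; set u := s ^+ n => u0 un.
rewrite mulrS natrM; set m := n%:R in Hn un *.
have m0 : 0 <= m by rewrite ler0n.
have H1 : (1 + 2 * m) * u * t <= 2 by nra.
have H2 : u * (m * t) <= 1 by nra.
have mt0 : 0 < m * e * t * t by lra.
have mt1 : 0 < m * t.
  by rewrite mulr_gt0.
have H3 : u * ((1 + 2 * m) * u * t) <= 2 * u by rewrite [leRHS]mulrC ler_wpM2l.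
rewrite -(ler_pM2r (mulr_gt0 t0 mt1)).
have -> : (1 + 2 * m) * u ^+ 2 * (t * (m * t)) = u * ((1 + 2 * m) * u * t) * (m * t) by ring.
apply: (@le_trans _ _ (2 * u * (m * t))); first by rewrite ler_wpM2r// ltW.
apply: (@le_trans _ _ 2); first lra.
have -> : e * (t * (m * t)) = m * e * t * t by ring.
lra.
Qed.

(** P averages the values of W at the conjugates of the powers of w, against the
    nonnegative kernel |1 + z w^k|^(2 n), which concentrates near z.  Terms near z
    are controlled by uniform continuity, the others by [geometric_decay].  The
    phase z^n that makes P a polynomial does not affect the modulus. *)
Lemma weierstrass_circle (W : R[i] -> R) (B : R) :
  (forall z, cabs z = 1 -> 0 <= W z <= B) ->
  (forall e, 0 < e -> exists2 d, 0 < d & forall a b, cabs a = 1 -> cabs b = 1 ->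
    cabs (a - b) < d -> `|W a - W b| <= e) ->
  forall e, 0 < e -> exists P : {poly R[i]}, forall z, cabs z = 1 ->
    `|cabs P.[z] - W z| <= e.
Proof.
move=> WB Wc e e0.
have B0 : 0 <= B by have /andP[+ +] := WB 1 (cabs1 R); exact: le_trans.
have [d0 d00 Hd0] := Wc _ (divr_gt0 e0 (ltr0Sn R 1)).
have [d [d_gt0 d1 Hd]] : exists d, [/\ 0 < d, d <= 1 & forall a b, cabs a = 1 ->
    cabs b = 1 -> cabs (a - b) < d -> `|W a - W b| <= e / 2].
  exists (Num.min d0 1); rewrite lt_min d00 ltr01 ge_min lexx orbT; split=> // a b a1 b1.
  by rewrite lt_min => /andP[/Hd0 H _]; exact: H.
(* At distance d from z the kernel is a power of 4 - d^2, against the maximum 4;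
   the ratio 1 - d^2 / 4 is at most (1 - t)^2. *)
pose t := d ^+ 2 / 8.
have t01 : 0 < t <= 1.
  have : d ^+ 2 <= 1 by rewrite expr_le1// ltW.
  have : 0 < d ^+ 2 by rewrite exprn_gt0.
  rewrite /t; lra.
have B2 : 0 < 4 * (B + 1) by lra.
have [n Hn] := geometric_decay t01 (divr_gt0 e0 B2).
have [w wn] := prim_root_exists (ltn0Sn n).
pose c : R := (n.+1 * 'C(2 * n, n))%:R.
have c0 : 0 < c.
  by rewrite ltr0n muln_gt0 /= bin_gt0 mul2n -addnn leq_addr.
pose P : {poly R[i]} := \sum_(k < n.+1)
  ((W (w ^+ k)^-1)%:C * w ^+ k / c%:C) *: (1 + w ^+ k *: 'X) ^+ (2 * n).
exists P => z z1.
have PE : P.[z] = \sum_(k < n.+1)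
    (W (w ^+ k)^-1)%:C * w ^+ k / c%:C * (1 + z * w ^+ k) ^+ (2 * n).
  rewrite /P horner_sum; apply: eq_bigr => k _.
  by rewrite hornerZ horner_exp hornerD hornerZ hornerX hornerC (mulrC z).
have wk1 (k : nat) : cabs (w ^+ k) = 1.
  apply/eqP; rewrite -(@pexpr_eq1 _ _ n.+1) ?cabs_ge0//.
  by rewrite -cabsX -exprM mulnC exprM (prim_expr_order wn) expr1n cabs1.
have cC0 : c%:C != 0 :> R[i] by rewrite -cabs_eq0 cabs_real normr_eq0 gt_eqF.
have -> : W z = cabs ((W z)%:C * z ^+ n).
  rewrite cabsM cabsX z1 expr1n mulr1 cabs_real ger0_norm//.
  by have /andP[] := WB _ z1.
apply: le_trans (cabs_dist _ _) _.
have -> : P.[z] - (W z)%:C * z ^+ n = \sum_(k < n.+1)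
    ((W (w ^+ k)^-1 - W z)%:C * w ^+ k / c%:C * (1 + z * w ^+ k) ^+ (2 * n)).
  have -> : (W z)%:C * z ^+ n = \sum_(k < n.+1)
      ((W z)%:C * w ^+ k / c%:C * (1 + z * w ^+ k) ^+ (2 * n)).
    apply: (mulfI cC0); rewrite mulrCA.
    have -> : c%:C = (n.+1 * 'C(2 * n, n))%:R by rewrite (rmorph_nat (real_complex R)).
    rewrite -(central_binomial_sum _ wn) -(rmorph_nat (real_complex R)) -/c !mulr_sumr.
    apply: eq_bigr => k _; set v := (1 + _) ^+ _.
    by rewrite -[LHS]mul1r -(divff cC0); ring.
  rewrite PE -sumrB; apply: eq_bigr => k _.
  by rewrite rmorphB /=; ring.
pose q : R := (4 ^+ n) * ((1 - t) ^+ n) ^+ 2.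
have q0 : 0 <= q by apply: mulr_ge0; [exact: exprn_ge0|exact: sqr_ge0].
pose K k := cabs (1 + z * w ^+ k) ^+ (2 * n).
have K0 k : 0 <= K k by rewrite exprn_ge0 ?cabs_ge0.
have e2 : 0 <= e / 2 by rewrite divr_ge0// ltW.
have term (k : 'I_n.+1) : `|W (w ^+ k)^-1 - W z| * K k <= e / 2 * K k + 2 * B * q.
  have wV1 : cabs (w ^+ k)^-1 = 1 by rewrite cabsV wk1 invr1.
  have wk0 : w ^+ k != 0 by rewrite -cabs_gt0 wk1.
  have [near|far] := ltP (cabs ((w ^+ k)^-1 - z)) d.
    apply: (@le_trans _ _ (e / 2 * K k)); last by rewrite lerDl; apply: mulr_ge0 => //; exact: mulr_ge0.
    by rewrite ler_wpM2r// Hd.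
  apply: (@le_trans _ _ (2 * B * q)); last first.
    by rewrite lerDr mulr_ge0 ?K0.
  apply: ler_pM => //.
    by have := WB _ wV1; have := WB _ z1; rewrite ler_norml; lra.
  rewrite /K /q exprM (exprAC _ n 2) -exprMn.
  apply: lerXn2r; rewrite ?nnegrE ?sqr_ge0//.
    by rewrite mulr_ge0// sqr_ge0.
  set v := z * w ^+ k.
  have v1 : cabs v = 1 by rewrite cabsM z1 wk1 mulr1.
  have dv : d <= cabs (1 - v).
    apply: le_trans far _; rewrite -[X in _ <= cabs X](_ : w ^+ k * ((w ^+ k)^-1 - z) = _).
      by rewrite cabsM wk1 mul1r.
    by rewrite mulrBr divff// mulrC.
  have dv2 : d ^+ 2 <= cabs (1 - v) ^+ 2 by rewrite ler_pXn2r// nnegrE ?cabs_ge0// ltW.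
  have E : cabs (1 + v) ^+ 2 = 4 - cabs (1 - v) ^+ 2.
    have : cabs v ^+ 2 = 1 by rewrite v1 expr1n.
    rewrite !cabs_sqr; case: (v) => x y /=; lra.
  have : 0 <= t ^+ 2 by rewrite sqr_ge0.
  rewrite E /t; set D := d ^+ 2 in dv2 *; lra.
apply: le_trans (ler_cabs_sum _ _ _) _.
apply: (@le_trans _ _ (\sum_(k < n.+1) (e / 2 * K k + 2 * B * q) / c)).
  apply: ler_sum => k _; rewrite !cabsM cabsV !cabs_real wk1 mulr1 cabsX (gtr0_norm c0).
  by rewrite mulrAC ler_wpM2r// ?invr_ge0 ?(ltW c0)// term.
rewrite -mulr_suml big_split /= -mulr_sumr kernel_sum// -/c sumr_const card_ord -(mulr_natr _ n.+1).
rewrite mulrDl mulfK ?gt_eqF//.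
suff : 2 * B * q * n.+1%:R / c <= e / 2 by rewrite [X in _ -> _ <= X](splitr e) lerD2l.
rewrite ler_pdivrMr//.
have H4 : 4 ^+ n <= (2 * n).+1%:R * 'C(2 * n, n)%:R :> R.
  by rewrite -natrX -natrM ler_nat expn4_le_bin.
have H5 : q <= e / (4 * (B + 1)) * 'C(2 * n, n)%:R.
  rewrite /q; apply: le_trans (ler_wpM2r (sqr_ge0 _) H4) _.
  by rewrite mulrAC ler_wpM2r.
rewrite /c natrM.
have -> : e / 2 * (n.+1%:R * 'C(2 * n, n)%:R) = e / 2 * 'C(2 * n, n)%:R * n.+1%:R by ring.
apply: ler_wpM2r => //.
apply: (@le_trans _ _ (2 * B * (e / (4 * (B + 1)) * 'C(2 * n, n)%:R))).
  by apply: ler_wpM2l => //; exact: mulr_ge0.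
rewrite mulrA; apply: ler_wpM2r => //.
have -> : 2 * B * (e / (4 * (B + 1))) = e / 2 * (B / (B + 1)) by field; lra.
rewrite ler_piMr ?divr_ge0 ?(ltW e0)// ler_pdivrMr; lra.
Qed.

(** On the unit circle |z - a| = |1 - conj(a) z|, so each zero inside the disc
    can be reflected to the outside without changing the modulus. *)
Lemma reflect_roots (P : {poly R[i]}) : (forall z, cabs z = 1 -> P.[z] != 0) ->
  exists Q : {poly R[i]}, (forall z, cabs z = 1 -> cabs Q.[z] = cabs P.[z]) /\
    forall z, cabs z <= 1 -> Q.[z] != 0.
Proof.
have [s ->] := closed_field_poly_normal P; set c := lead_coef P.
move=> P0; have c0 : c != 0.
  by have := P0 1 (cabs1 R); rewrite hornerZ mulf_eq0 negb_or => /andP[].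
suff [Q [QE Q0]] : exists Q : {poly R[i]},
    (forall z, cabs z = 1 -> cabs Q.[z] = cabs (\prod_(a <- s) ('X - a%:P)).[z]) /\
    forall z, cabs z <= 1 -> Q.[z] != 0.
  exists (c *: Q); split=> z z1; rewrite !hornerZ; first by rewrite !cabsM QE.
  by rewrite mulf_neq0 ?Q0.
have {}P0 z : cabs z = 1 -> (\prod_(a <- s) ('X - a%:P)).[z] != 0.
  by move=> /P0; rewrite hornerZ mulf_eq0 negb_or => /andP[].
elim: s P0 => [|a s IH] P0.
  exists 1; split=> z z1; first by rewrite big_nil.
  by rewrite hornerC oner_neq0.
have [z z1|Q [QE Q0]] := IH.
  by have := P0 z z1; rewrite big_cons hornerM mulf_eq0 negb_or => /andP[].
have a1 : cabs a != 1.
  apply/negP => /eqP /P0; rewrite big_cons hornerM hornerXsubC subrr mul0r eqxx.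
  by [].
have [alt|agt] := ltP (cabs a) 1.
  exists ((1 - a^* *: 'X) * Q); split=> z z1.
    rewrite big_cons !hornerM !cabsM QE//; congr (_ * _).
    rewrite hornerXsubC hornerD hornerN hornerZ hornerX hornerC.
    have := moebius_eq (- a) z1; rewrite rmorphN /= => ->.
    by rewrite mulNr.
  rewrite hornerM mulf_neq0 ?Q0//.
  rewrite hornerD hornerN hornerZ hornerX hornerC subr_eq0.
  apply/eqP => /(congr1 (@cabs R)); rewrite cabs1 cabsM cabs_conj => E.
  have : cabs a * cabs z <= cabs a by rewrite ler_piMr// cabs_ge0.
  by lra.
exists (('X - a%:P) * Q); split=> z z1.
  by rewrite big_cons !hornerM !cabsM QE.
rewrite hornerM mulf_neq0 ?Q0// hornerXsubC subr_eq0.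
by apply/eqP => E; move: a1 agt; rewrite -E eq_le z1 => /= /negbTE ->.
Qed.

(** As 1 <= W, an absolute approximation of W within e is also a relative one;
    e is chosen so that (1 + e) / (1 - e) = k. *)
Lemma outer_poly (W : R[i] -> R) (B r k : R) : 0 < r -> 1 < k ->
  (forall z, cabs z = r -> 1 <= W z <= B) ->
  (forall e, 0 < e -> exists2 d, 0 < d & forall a b, cabs a = r -> cabs b = r ->
    cabs (a - b) < d -> `|W a - W b| <= e) ->
  exists Q : {poly R[i]}, (forall z, cabs z <= r -> Q.[z] != 0) /\
    forall z, cabs z = r -> W z <= cabs Q.[z] <= k * W z.
Proof.
move=> r0 k1 WB Wc.
have rC : cabs (r%:C : R[i]) = r by rewrite cabs_real gtr0_norm.
have rC0 : r%:C != 0 :> R[i] by rewrite -cabs_gt0 rC.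
have cr z : cabs z = 1 -> cabs (r%:C * z) = r by move=> z1; rewrite cabsM rC z1 mulr1.
pose V z := W (r%:C * z).
have VB z : cabs z = 1 -> 0 <= V z <= B.
  by move=> /cr /WB; rewrite /V; lra.
pose e := (k - 1) / (k + 1).
have e0 : 0 < e by rewrite divr_gt0; lra.
have e1 : e < 1 by rewrite ltr_pdivrMr; lra.
have [e2|P HP] := weierstrass_circle VB _ e0.
  move=> /Wc[d d0 Hd]; exists (d / r); first by rewrite divr_gt0.
  move=> a b a1 b1; rewrite ltr_pdivlMr// => ab; apply: Hd; rewrite ?cr//.
  by rewrite -mulrBr cabsM rC mulrC.
have P0 z : cabs z = 1 -> P.[z] != 0.
  move=> z1; rewrite -cabs_gt0; have := HP _ z1; have := WB _ (cr _ z1).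
  by rewrite ler_norml /V; lra.
have [Q [QE Q0]] := reflect_roots P0.
exists ((1 - e)%:C^-1 *: (Q \Po (r^-1%:C *: 'X))).
have rV : r^-1%:C = (r%:C)^-1 :> R[i] by rewrite fmorphV.
have QEz z : ((1 - e)%:C^-1 *: (Q \Po (r^-1%:C *: 'X))).[z] = (1 - e)%:C^-1 * Q.[z / r%:C].
  by rewrite hornerZ horner_comp hornerZ hornerX rV (mulrC z).
have e1C : cabs (1 - e)%:C^-1 = (1 - e)^-1.
  by rewrite cabsV cabs_real ger0_norm//; lra.
split=> z zr; rewrite QEz.
  rewrite mulf_neq0//; first by rewrite -cabs_gt0 e1C invr_gt0; lra.
  by apply: Q0; rewrite cabsM cabsV rC ler_pdivrMr// mul1r.
have z1 : cabs (z / r%:C) = 1 by rewrite cabsM cabsV rC zr divff// gt_eqF.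
have Vz : V (z / r%:C) = W z by rewrite /V mulrC divfK.
rewrite cabsM e1C QE//; have := HP _ z1; have := WB _ zr; rewrite Vz ler_norml.
set p := cabs _; set v := W z => Hv Hp.
have e10 : 0 < 1 - e by lra.
have ke : k * (1 - e) = 1 + e by rewrite /e; field; lra.
rewrite (mulrC _ p) ler_pdivlMr// ler_pdivrMr//; apply/andP; split; first nra.
rewrite mulrAC ke; nra.
Qed.

End weierstrass.

(** * Second-order Taylor estimates for 1/Q *)

Section rational.
Context (R : realType).

(** The difference quotient of A/Q is again a fraction with denominator Q, which
    makes Cauchy-type estimates available from the maximum principle alone. *)
Lemma rat_slope (A Q : {poly R[i]}) w : Q.[w] != 0 -> exists B : {poly R[i]},
  forall z, Q.[z] != 0 -> A.[z] / Q.[z] - A.[w] / Q.[w] = (z - w) * (B.[z] / Q.[z]).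
Proof.
move=> Qw.
have /factor_theorem[B BE] : root (A - (A.[w] / Q.[w]) *: Q) w.
  by rewrite /root hornerD hornerN hornerZ divfK// subrr.
exists B => z Qz; have := congr1 (horner ^~ z) BE.
rewrite hornerD hornerN hornerZ hornerM hornerXsubC => E.
by rewrite mulrCA mulrA -E mulrBl mulfK.
Qed.

(** On the circle |z - w| >= r - |w|; the bound extends inside by the maximum
    principle. *)
Lemma rat_slope_bound (A Q : {poly R[i]}) (r M : R) w : 0 < r ->
  (forall z, cabs z <= r -> Q.[z] != 0) ->
  (forall z, cabs z <= r -> cabs (A.[z] / Q.[z]) <= M) -> cabs w < r ->
  exists2 B : {poly R[i]}, forall z, cabs z <= r ->
    A.[z] / Q.[z] - A.[w] / Q.[w] = (z - w) * (B.[z] / Q.[z]) &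
    forall z, cabs z <= r -> cabs (B.[z] / Q.[z]) <= 2 * M / (r - cabs w).
Proof.
move=> r0 Q0 AM wr; have [B BE] := rat_slope A (Q0 w (ltW wr)).
exists B => [z zr|]; first by apply: BE; exact: Q0.
apply: max_modulus => // [z zr|z zr].
  apply: cdiffM; first exact: cdiff_horner.
  by apply: cdiffV; [exact: Q0|exact: cdiff_horner].
have zr' : cabs z <= r by rewrite zr.
rewrite ler_pdivlMr ?subr_gt0// [leLHS]mulrC.
apply: (@le_trans _ _ (cabs (A.[z] / Q.[z] - A.[w] / Q.[w]))).
  rewrite BE ?Q0// (cabsM (z - w)) ler_wpM2r ?cabs_ge0//.
  by have := cabs_dist z w; rewrite zr ler_norml; lra.
apply: le_trans (cabsB _ _) _; have := AM _ zr'; have := AM _ (ltW wr); lra.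
Qed.

(** Two successive difference quotients.  The bounds depend only on r and w, so
    they survive in the limit of a sequence of functions 1/Q and prove that the
    limit is differentiable. *)
Lemma inv_poly_taylor (Q : {poly R[i]}) (r : R) w : 0 < r ->
  (forall z, cabs z <= r -> Q.[z] != 0) ->
  (forall z, cabs z <= r -> cabs (Q.[z])^-1 <= 1) -> cabs w < r ->
  exists2 d : R[i], cabs d <= 2 / (r - cabs w) & forall z, cabs z <= r ->
    cabs ((Q.[z])^-1 - (Q.[w])^-1 - d * (z - w)) <= 4 / (r - cabs w) ^+ 2 * cabs (z - w) ^+ 2.
Proof.
move=> r0 Q0 Q1 wr; have rw : 0 < r - cabs w by rewrite subr_gt0.
have oneE z : (Q.[z])^-1 = (1 : {poly R[i]}).[z] / Q.[z] by rewrite hornerC div1r.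
have A1 z : cabs z <= r -> cabs ((1 : {poly R[i]}).[z] / Q.[z]) <= 1.
  by move=> zr; rewrite -oneE Q1.
have [B BE BM] := rat_slope_bound r0 Q0 A1 wr.
have [A AE AM] := rat_slope_bound r0 Q0 BM wr.
exists (B.[w] / Q.[w]).
  by apply: le_trans (BM _ (ltW wr)) _; rewrite mulr1.
move=> z zr; have := BE _ zr; rewrite -!oneE => ->; rewrite [X in X - _]mulrC -mulrBl AE//.
rewrite mulrAC -expr2 cabsM cabsX [leLHS]mulrC ler_wpM2r ?sqr_ge0//; apply: le_trans (AM _ zr) _.
rewrite le_eqVlt; apply/orP; left; apply/eqP; field; exact: lt0r_neq0.
Qed.

End rational.

(** * Sequential arguments with an ultrafilter on the integers *)

Section sequence.
Context (R : realType).

Lemma ultra_nat : exists2 U : set_system nat, UltraFilter U &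
  forall e : R, 0 < e -> U [set n | n.+1%:R^-1 < e].
Proof.
have [U [UU sub]] := ultraFilterLemma (eventually_filter).
exists U => // e e0; apply: sub.
exact: near_infty_natSinv_lt (PosNum e0).
Qed.

(** Otherwise two sequences a_n, b_n of points with |a_n - b_n| -> 0 violate the
    claim, and continuity fails at the limit of a_n along an ultrafilter. *)
Lemma cdiff_unif_continuous (f : R[i] -> R[i]) (r : R) :
  (forall z, cabs z <= r -> cdiff f z) -> forall e, 0 < e ->
  exists2 d, 0 < d & forall a b, cabs a <= r -> cabs b <= r -> cabs (a - b) < d ->
    cabs (f a - f b) < e.
Proof.
move=> df e e0; apply: contrapT => H.
have {}H n : exists p : R[i] * R[i], [/\ cabs p.1 <= r, cabs p.2 <= r,
    cabs (p.1 - p.2) < n.+1%:R^-1 & e <= cabs (f p.1 - f p.2)].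
  apply: contrapT => H'; apply: H; exists n.+1%:R^-1; first by rewrite invr_gt0.
  move=> a b ar br ab; rewrite ltNge; apply/negP => fab; apply: H'.
  by exists (a, b).
have [p Hp] := choice H.
have [U UU Un] := ultra_nat.
have pl : ucvg U (fun n => (p n).1) (ulim U (fun n => (p n).1)).
  by apply: (@ultra_bounded_cvg _ _ _ _ _ r); apply: filterE => n /=; case: (Hp n).
set l := ulim _ _ in pl.
have lr : cabs l <= r by apply: ucvg_le pl _; apply: filterE => n /=; case: (Hp n).
have [s s0 Hs] := cdiff_continuous (df _ lr) (divr_gt0 e0 (ltr0Sn R 1)).
have s2 : 0 < s / 2 by rewrite divr_gt0.
have [n [/= H1 H2]] := filter_ex (filterI (pl _ s2) (Un _ s2)).
have [_ _ H3 H4] := Hp n; have H5 := lt_trans H3 H2.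
have ss : s / 2 < s by lra.
have K1 := Hs (p n).1 (lt_trans H1 ss).
have K2 : cabs ((p n).2 - l) < s.
  have -> : (p n).2 - l = ((p n).1 - l) - ((p n).1 - (p n).2) by ring.
  by apply: le_lt_trans (cabsB _ _) _; rewrite (splitr s); exact: ltrD.
have {}K2 := Hs _ K2.
have E : f (p n).1 - f (p n).2 = (f (p n).1 - f l) - (f (p n).2 - f l) by ring.
by have := cabsB (f (p n).1 - f l) (f (p n).2 - f l); rewrite -E; lra.
Qed.

End sequence.

(** * Outer functions *)

Section outer.
Context (R : realType).

(** The function h plays the role of the outer function with boundary modulus
    1/W, where W = max(1, |f|/e).  The last clause expresses that -log|h| is the
    least harmonic majorant of log W: with v = log W and u = -log|h|, it compares
    log(|g|/m) with a multiple of u - v, whose means over the circles of radius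
    r_n tend to 0.  Exponentiated, u - u_n on the circle becomes |Q_n h|, where
    Q_n has modulus nearly W there, and the comparison is between analytic
    functions. *)
Theorem outer_function (f : R[i] -> R[i]) (B e : R) :
  (forall z, cabs z < 1 -> cdiff f z) -> (forall z, cabs z < 1 -> cabs (f z) <= B) ->
  0 < e ->
  exists h : R[i] -> R[i],
    [/\ forall z, cabs z < 1 -> cdiff h z,
        forall z, cabs z < 1 -> cabs (h z) <= 1,
        forall z, cabs z < 1 -> cabs (h z * f z) <= e &
        forall (g : R[i] -> R[i]) (G m d : R),
          (forall z, cabs z < 1 -> cdiff g z) -> (forall z, cabs z < 1 -> cabs (g z) <= G) ->
          0 < m -> 0 < d <= 1 ->
          (forall z, cabs z < 1 -> e <= cabs (f z) \/ 1 - d <= cabs (h z) ->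
             cabs (g z) <= m) ->
          forall z, cabs z < 1 -> cabs (g z) <= m].
Proof.
move=> df fB e0.
(* The shift by two keeps the radius r 0 positive. *)
pose r n : R := 1 - n.+2%:R^-1.
have r0 n : 0 < r n.
  by rewrite subr_gt0 invf_lt1// ltr1n.
have r1 n : r n < 1 by rewrite gtrBl invr_gt0.
pose k n : R := 1 + n.+1%:R^-1.
have k1 n : 1 < k n by rewrite ltrDl invr_gt0.
have k2 n : k n <= 2.
  by rewrite -[leRHS](_ : 1 + 1 = 2)// lerD2l invf_le1// ler1n.
pose W z := Num.max 1 (cabs (f z) / e).
pose L := Num.max 1 (B / e).
have WL z : cabs z < 1 -> 1 <= W z <= L.
  move=> z1; rewrite le_max lexx /= /W /L ge_max le_max lexx /= le_max.
  by rewrite ler_pM2r ?invr_gt0// fB// orbT.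
have We z : cabs (f z) <= e * W z.
  by rewrite -ler_pdivrMl// mulrC le_max lexx orbT.
have L1 : 1 <= L by rewrite le_max lexx.
have QE n : exists Q : {poly R[i]}, (forall z, cabs z <= r n -> Q.[z] != 0) /\
    forall z, cabs z = r n -> W z <= cabs Q.[z] <= k n * W z.
  apply: (outer_poly (r0 n) (k1 n)) => [z zr|d d0].
    by apply: WL; rewrite zr r1.
  have [|s s0 Hs] := @cdiff_unif_continuous R f (r n) _ (d * e) (mulr_gt0 d0 e0).
    by move=> z zr; apply: df; apply: le_lt_trans zr _.
  exists s => // a b ar br ab; rewrite /W.
  have H : `|cabs (f a) / e - cabs (f b) / e| <= d.
    rewrite -mulrBl normrM [X in _ * X]gtr0_norm ?invr_gt0// ler_pdivrMr//.
    apply: le_trans (cabs_dist _ _) _; apply: ltW; apply: Hs => //; by rewrite ?ar ?br.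
  move: H; set x := _ / e; set y := _ / e; rewrite !ler_norml !maxEle.
  by case: ifPn; case: ifPn; rewrite -?ltNge; lra.
have [Q HQ] := choice QE.
have Q0 n z : cabs z <= r n -> (Q n).[z] != 0 by case: (HQ n) => H _; exact: H.
have QW n z : cabs z = r n -> W z <= cabs (Q n).[z] <= k n * W z.
  by case: (HQ n) => _ H; exact: H.
have lt1 n z : cabs z <= r n -> cabs z < 1 by move=> H; exact: le_lt_trans (r1 n).
have dQV n z : cabs z <= r n -> cdiff (fun w => ((Q n).[w])^-1) z.
  by move=> zr; apply: cdiffV; [exact: Q0|exact: cdiff_horner].
have QV1 n z : cabs z <= r n -> cabs ((Q n).[z])^-1 <= 1.
  apply: (max_modulus (r := r n) (F := fun z => ((Q n).[z])^-1)) => // [w|w wr]; first exact: dQV.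
  have Hw : 1 <= cabs (Q n).[w].
    have W1 : 1 <= W w by rewrite le_max lexx.
    by have /andP[+ _] := QW _ _ wr; exact: le_trans.
  by rewrite cabsV invf_le1//; lra.
have QVf n z : cabs z <= r n -> cabs (((Q n).[z])^-1 * f z) <= e.
  apply: (max_modulus (r := r n) (F := fun z => ((Q n).[z])^-1 * f z)) => // [w wr|w wr].
    by apply: cdiffM; [exact: dQV|apply: df; exact: lt1 wr].
  have := QW _ _ wr; have Hw : 1 <= W w by rewrite le_max lexx.
  move=> /andP[HW _]; rewrite cabsM cabsV mulrC ler_pdivrMr; last by lra.
  by apply: le_trans (We w) _; rewrite ler_wpM2l// ltW.
have QL n z : cabs z <= r n -> cabs (Q n).[z] <= 2 * L.
  apply: (max_modulus (r := r n) (F := fun z => (Q n).[z])) => // [w wr|w wr]; first exact: cdiff_horner.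
  have /andP[_ H] := QW _ _ wr; apply: le_trans H _.
  have w1 : cabs w < 1 by rewrite wr.
  have /andP[W1 W2] := WL _ w1.
  by apply: ler_pM => //; [apply: ltW; apply: lt_trans (k1 n)|lra].
have [U UU Un] := ultra_nat R.
have Ur (s : R) : s < 1 -> U [set n | s <= r n].
  move=> s1; have : 0 < 1 - s by rewrite subr_gt0.
  move=> s1'; apply: filterS (Un _ s1') => n /= H.
  have H' : n.+2%:R^-1 <= n.+1%:R^-1 :> R by rewrite lef_pV2 ?posrE// ler_nat.
  by have := le_lt_trans H' H; rewrite /r; set x := _^-1; lra.
pose hn z n := ((Q n).[z])^-1.
pose h z := ulim U (hn z).
have hE z : cabs z < 1 -> ucvg U (hn z) (h z).
  move=> z1; apply: (@ultra_bounded_cvg _ _ _ _ _ 1).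
  by apply: filterS (Ur _ z1) => n /=; exact: QV1.
have h1 z : cabs z < 1 -> cabs (h z) <= 1.
  move=> z1; apply: ucvg_le (hE _ z1) _.
  by apply: filterS (Ur _ z1) => n /=; exact: QV1.
have hf z : cabs z < 1 -> cabs (h z * f z) <= e.
  move=> z1; rewrite mulrC.
  apply: ucvg_le (ucvgZ (f z) (hE _ z1)) _.
  by apply: filterS (Ur _ z1) => n /=; rewrite mulrC; exact: QVf.
have dh z : cabs z < 1 -> cdiff h z.
  move=> z1; pose s := (cabs z + 1) / 2.
  have zs : cabs z < s by rewrite /s; lra.
  have s1 : s < 1 by rewrite /s; lra.
  pose D := 2 / (s - cabs z); pose K := 4 / (s - cabs z) ^+ 2.
  have sz : 0 < s - cabs z by rewrite subr_gt0.
  have K0 : 0 < K by rewrite divr_gt0// exprn_gt0.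
  have dE n : exists d : R[i], s <= r n -> cabs d <= D /\ forall w, cabs w <= s ->
      cabs (hn w n - hn z n - d * (w - z)) <= K * cabs (w - z) ^+ 2.
    have [sr|] := leP s (r n); last by exists 0.
    have [d d1 d2] := inv_poly_taylor (r0 n) (@Q0 n) (@QV1 n) (lt_le_trans zs sr).
    have srz : s - cabs z <= r n - cabs z by rewrite lerD2r.
    have rz0 : 0 < r n - cabs z by apply: lt_le_trans srz.
    exists d => _; split.
      by apply: le_trans d1 _; rewrite ler_wpM2l// lef_pV2 ?posrE.
    move=> w ws; apply: le_trans (d2 _ (le_trans ws sr)) _.
    rewrite ler_wpM2r ?sqr_ge0// ler_wpM2l// lef_pV2 ?posrE ?exprn_gt0//.
    by apply: lerXn2r => //; rewrite nnegrE ltW.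
  have [d Hd] := choice dE.
  have dl : ucvg U d (ulim U d).
    apply: (@ultra_bounded_cvg _ _ _ _ _ D).
    by apply: filterS (Ur _ s1) => n /= /Hd[].
  exists (ulim U d) => x x0.
  exists (Num.min (s - cabs z) (x / K)); first by rewrite lt_min sz divr_gt0.
  move=> w; rewrite lt_min => /andP[wz wx].
  have ws : cabs w <= s by have := cabsD (w - z) z; rewrite subrK; lra.
  have w1 : cabs w < 1 by apply: le_lt_trans ws s1.
  apply: (@le_trans _ _ (K * cabs (w - z) ^+ 2)).
    have H2 : ucvg U (fun n => hn w n - hn z n - (w - z) * d n)
        (h w - h z - (w - z) * ulim U d).
      apply: ucvgD; last by apply: ucvgN; exact: ucvgZ.
      by apply: ucvgD; [exact: hE|apply: ucvgN; exact: hE].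
    rewrite (mulrC (ulim U d)); apply: ucvg_le H2 _.
    by apply: filterS (Ur _ s1) => n /= /Hd[_ H]; rewrite (mulrC _ (d n)); exact: H.
  rewrite expr2 mulrA ler_wpM2r ?cabs_ge0// mulrC -ler_pdivlMr//; exact: ltW.
exists h; split=> // g G m d dg gG m0 d01 gm z z1.
have G0 : 0 <= G by apply: le_trans (gG 0 _); rewrite ?cabs_ge0 ?cabs0.
(* C is so large that, on the part of the circle where |h| < 1 - d, the factor
   (Q_n h)^C outweighs the bound G of g. *)
have [C HC] : exists C, G * (1 - d) ^+ C <= m.
  have G1 : 0 < G + 1 by lra.
  have [n Hn] := geometric_decay d01 (divr_gt0 m0 G1).
  exists (n * 2)%N; rewrite exprM.
  apply: (@le_trans _ _ ((G + 1) * (m / (G + 1)))); last by rewrite mulrC divfK// gt_eqF.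
  apply: ler_pM; rewrite ?sqr_ge0 ?lerDl//; apply: le_trans Hn.
  by rewrite ler_peMl ?sqr_ge0// ler1n.
(* The division by k n makes |u w n| <= 1 on the circle of radius r n exactly. *)
pose u w n := (Q n).[w] * h w / (k n)%:C.
have kC n : cabs (k n)%:C^-1 = (k n)^-1.
  by rewrite cabsV cabs_real gtr0_norm//; apply: lt_trans (k1 n).
have k0 n : 0 < k n by apply: lt_trans (k1 n).
have un : ucvg U (u z) 1.
  have H1 : ucvg U (fun n => (Q n).[z] * h z) 1.
    move=> x x0; have L0 : 0 < 2 * L by lra.
    apply: filterS2 (hE z z1 _ (divr_gt0 x0 L0)) (Ur _ z1) => n /= H zr.
    have -> : (Q n).[z] * h z - 1 = (Q n).[z] * (h z - hn z n).
      by rewrite mulrBr /hn divff// Q0.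
    move: H; rewrite ltr_pdivlMr// cabsM cabsC; apply: le_lt_trans.
    by rewrite mulrC ler_wpM2l ?cabs_ge0// QL.
  rewrite -[1](mulr1 1); apply: ucvgM H1 _ => x x0.
  apply: filterS (Un _ x0) => n /=; apply: le_lt_trans.
  have -> : (k n)%:C^-1 - 1 = - (n.+1%:R^-1 / k n)%:C.
    rewrite -fmorphV -(rmorph1 (real_complex R)) -rmorphB -rmorphN /=; congr (_ %:C).
    by move: (k0 n); rewrite /k; set a := n.+1%:R^-1 => kn; field; exact: lt0r_neq0.
  rewrite cabsN cabs_real ger0_norm; last by rewrite divr_ge0// ltW.
  by rewrite ler_pdivrMr// ler_peMr// ltW.
have F1 : ucvg U (fun n => g z * u z n ^+ C) (g z).
  by rewrite -[X in ucvg _ _ X]mulr1 -(expr1n _ C); apply: ucvgZ; exact: ucvgX.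
apply: ucvg_le F1 _; apply: filterS (Ur _ z1) => n /=.
apply: (max_modulus (r := r n) (F := fun w => g w * u w n ^+ C)) => // [w wr|w wr].
  have w1 := lt1 _ _ wr.
  apply: cdiffM; first exact: dg.
  apply: cdiffX; apply: cdiffM; last exact: cdiff_cst.
  by apply: cdiffM; [exact: cdiff_horner|exact: dh].
have w1 : cabs w < 1 by rewrite wr.
have /andP[W1 _] := WL _ w1.
have /andP[_ QkW] := QW _ _ wr.
have hW : cabs (h w) * W w <= 1.
  rewrite /W maxEle; case: ifPn => _; last by rewrite mulr1 h1.
  by rewrite mulrA -cabsM ler_pdivrMr// mul1r hf.
have uE : cabs (u w n) <= cabs (h w) * W w.
  rewrite /u !cabsM kC ler_pdivrMr// mulrC -mulrA ler_wpM2l ?cabs_ge0//.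
  by rewrite mulrC.
rewrite cabsM cabsX.
have [gs|gl] := leP (cabs (g w)) m.
  rewrite -[leRHS]mulr1; apply: ler_pM; rewrite ?cabs_ge0 ?exprn_ge0 ?cabs_ge0//.
  by rewrite exprn_ile1 ?cabs_ge0//; apply: le_trans hW.
have fe : cabs (f w) < e.
  by rewrite ltNge; apply/negP => H; have := gm _ w1 (or_introl H); rewrite leNgt gl.
have hd : cabs (h w) < 1 - d.
  by rewrite ltNge; apply/negP => H; have := gm _ w1 (or_intror H); rewrite leNgt gl.
have WE : W w = 1.
  by rewrite /W maxEle; case: ifPn => //; rewrite ler_pdivlMr// mul1r leNgt fe.
apply: le_trans HC; apply: ler_pM; rewrite ?cabs_ge0 ?exprn_ge0 ?cabs_ge0 ?gG//.
apply: lerXn2r; rewrite ?nnegrE ?cabs_ge0//; first lra.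
by apply: le_trans uE _; rewrite WE mulr1 ltW.
Qed.

End outer.

(** * Bounded analytic functions *)

Section rnorm.
Context (R : realType) (X : normedModType R[i]).
Implicit Types x y : X.

(** As for the modulus, the norm as a real number. *)
Definition rnorm x : R := complex.Re `|x|.

Lemma rnormE x : `|x| = (rnorm x)%:C.
Proof. by rewrite /rnorm RRe_real// ger0_real. Qed.

Lemma rnorm_ge0 x : 0 <= rnorm x.
Proof. by have := normr_ge0 x; rewrite rnormE ler0c. Qed.

Lemma rnormZ (a : R[i]) x : rnorm (a *: x) = cabs a * rnorm x.
Proof. by apply: (@complexI R); rewrite rmorphM /= -!rnormE normrZ cabsE. Qed.

Lemma rnorm_ball x (M : R) : (`|x| <= M%:C) = (rnorm x <= M).
Proof. by rewrite rnormE lecR. Qed.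

End rnorm.

Section Hinf_disc.
Context (R : realType).
Implicit Types (f g h : Hinf R) (z : @disc R).

Lemma disc_cabs (w : R[i]) : disc w <-> cabs w < 1.
Proof. by rewrite /disc /= cabsE -[1]/(1%:C) ltcR. Qed.

Lemma disc_lt1 z : cabs (val z) < 1.
Proof. exact/disc_cabs/set_valP. Qed.

Lemma in_disc (w : R[i]) : cabs w < 1 -> exists z : @disc R, val z = w.
Proof. by move=> /disc_cabs wd; exists (SigSub (mem_set wd)). Qed.

(** A function on the disc as a function on the whole plane, to which the
    epsilon-delta calculus applies. *)
Lemma Hinf_ext f : exists2 F : R[i] -> R[i],
  forall w, cabs w < 1 -> cdiff F w & forall z, F (val z) = f z.
Proof.
exists ('valL_0 f) => [w /disc_cabs wd|z].
  by apply/cdiff_derivable; case: f => f /= /asboolP[af _]; exact: af.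
have := valLK 0 (f : @disc R -> R[i]); rewrite /sigL => H.
by have := congr1 (fun u : @disc R -> R[i] => u z) H.
Qed.

Lemma Hinf_of (F : R[i] -> R[i]) (M : R) :
  (forall w, cabs w < 1 -> cdiff F w) -> (forall w, cabs w < 1 -> cabs (F w) <= M) ->
  exists f, forall z, f z = F (val z).
Proof.
move=> dF FM; pose f z := F (val z).
have fP : f \in @Hinf_pred R.
  apply/asboolP; split; last first.
    by exists M%:C => z; rewrite cabsE lecR FM// disc_lt1.
  move=> w /disc_cabs w1; apply/cdiff_derivable.
  have r0 : 0 < 1 - cabs w by rewrite subr_gt0.
  apply: cdiff_ext r0 _ (dF _ w1) => v vw.
  have : cabs v < 1 by have := cabsD (v - w) w; rewrite subrK; lra.
  move=> /in_disc[z <-].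
  have := valLK 0 f; rewrite /sigL => H.
  by have := congr1 (fun u : @disc R -> R[i] => u z) H.
by exists (MkHinf fP).
Qed.

Lemma Hinf_ub f z : cabs (f z) <= rnorm f.
Proof.
rewrite -lecR -cabsE -rnormE Hinf_normE; apply: sup_norm_ub => //.
by case: f => f /= /asboolP[_ [M fM]]; exists M => w _.
Qed.

Lemma Hinf_le f (M : R) : (forall z, cabs (f z) <= M) -> rnorm f <= M.
Proof.
move=> fM; rewrite -rnorm_ball Hinf_normE; apply: sup_norm_le; first by exists point.
by move=> z _; rewrite cabsE lecR.
Qed.

Lemma HinfM f g z : (f * g) z = f z * g z. Proof. by []. Qed.
Lemma HinfD f g z : (f + g) z = f z + g z. Proof. by []. Qed.
Lemma HinfB f g z : (f - g) z = f z - g z. Proof. by []. Qed.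
Lemma HinfZ (a : R[i]) f z : (a *: f) z = a * f z. Proof. by []. Qed.
Lemma Hinf1 z : (1 : Hinf R) z = 1. Proof. by []. Qed.

Lemma Hinf_eq f g : (forall z, f z = g z) -> f = g.
Proof. by move=> fg; apply/val_inj/funext. Qed.

Lemma Hinf_inv f (c : R) : 0 < c -> (forall z, c <= cabs (f z)) -> exists g, f * g = 1.
Proof.
move=> c0 fc; have [F dF FE] := Hinf_ext f.
have F0 w : cabs w < 1 -> c <= cabs (F w).
  by move=> /in_disc[z <-]; rewrite FE.
have [||g gE] := @Hinf_of (fun w => (F w)^-1) c^-1.
- move=> w w1; apply: cdiffV; last exact: dF.
  by rewrite -cabs_gt0; apply: lt_le_trans c0 (F0 _ w1).
- move=> w w1; rewrite cabsV lef_pV2 ?posrE// ?F0//.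
  by apply: lt_le_trans c0 (F0 _ w1).
exists g; apply: Hinf_eq => z; rewrite HinfM Hinf1 gE FE divff//.
by rewrite -cabs_gt0; apply: lt_le_trans c0 (fc z).
Qed.

Theorem Hinf_outer f (e : R) : 0 < e -> exists h : Hinf R,
  [/\ forall z, cabs (h z) <= 1, forall z, cabs (h z * f z) <= e &
    forall g (m d : R), 0 < m -> 0 < d <= 1 ->
      (forall z, e <= cabs (f z) \/ 1 - d <= cabs (h z) -> cabs (g z) <= m) ->
      forall z, cabs (g z) <= m].
Proof.
move=> e0; have [F dF FE] := Hinf_ext f.
have [|H [dH H1 HF HK]] := @outer_function R F (rnorm f) e dF _ e0.
  by move=> w /in_disc[z <-]; rewrite FE Hinf_ub.
have [h hE] := Hinf_of dH H1; exists h; split=> [z|z|g m d m0 d01 gm z].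
- by rewrite hE H1// disc_lt1.
- by rewrite hE -FE HF// disc_lt1.
have [G dG GE] := Hinf_ext g.
rewrite -GE; apply: (HK G (rnorm g) m d) => //; last exact: disc_lt1.
  by move=> w /in_disc[v <-]; rewrite GE Hinf_ub.
by move=> w /in_disc[v <-]; rewrite GE FE -hE; exact: gm.
Qed.

End Hinf_disc.

(** * Characters and the Silov boundary *)

Section characters.
Context (R : realType).
Implicit Types (f g h : Hinf R) (phi psi : max_ideal_space (Hinf R)).

Lemma gelfandP phi : is_character (val phi : Hinf R -> R[i]).
Proof. exact: (set_valP phi). Qed.

Lemma gelfand_linear phi : linear (fun f => gelfand f phi).
Proof. by case: (gelfandP phi) => H1 H2 _; first [exact: H1 | exact: H2]. Qed.

Lemma gelfandM phi f g : gelfand (f * g) phi = gelfand f phi * gelfand g phi.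
Proof. by case: (gelfandP phi) => H1 H2 _; first [exact: H1 | exact: H2]. Qed.

Lemma gelfandZ phi a f : gelfand (a *: f) phi = a * gelfand f phi.
Proof.
have L := gelfand_linear phi.
have g0 : gelfand 0 phi = 0.
  have := L 1 0 0; rewrite !scale1r addr0 => /eqP.
  by rewrite -subr_eq0 opprD addNKr oppr_eq0 => /eqP.
by have := L a f 0; rewrite addr0 g0 addr0.
Qed.

Lemma gelfandD phi f g : gelfand (f + g) phi = gelfand f phi + gelfand g phi.
Proof. by have := gelfand_linear phi 1 f g; rewrite !scale1r. Qed.

Lemma gelfandB phi f g : gelfand (f - g) phi = gelfand f phi - gelfand g phi.
Proof. by rewrite -scaleN1r gelfandD gelfandZ mulN1r. Qed.

Lemma gelfand1 phi : gelfand 1 phi = 1.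
Proof.
have [_ _ [f f0]] := gelfandP phi.
apply: (mulIf f0); rewrite mul1r.
by rewrite -[val phi f]/(gelfand f phi) -gelfandM mul1r.
Qed.

(** If |phi(f)| > ||f||, then phi(f) - f is bounded away from 0 on the disc, hence
    invertible, although phi maps it to 0. *)
Lemma gelfand_le phi f : cabs (gelfand f phi) <= rnorm f.
Proof.
rewrite leNgt; apply/negP => H.
pose l := gelfand f phi.
have c0 : 0 < cabs l - rnorm f by rewrite subr_gt0.
have [|g gE] := @Hinf_inv R (l *: 1 - f) _ c0.
  move=> z; rewrite HinfB HinfZ Hinf1 mulr1.
  by have := cabs_dist l (f z); have := Hinf_ub f z; rewrite ler_norml; lra.
have := gelfandM phi (l *: 1 - f) g.
rewrite gE gelfand1 gelfandB gelfandZ gelfand1 mulr1 subrr mul0r => /eqP.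
by rewrite oner_eq0.
Qed.

Lemma eval_limit (U : set_system nat) {UU : UltraFilter U} (z : nat -> @disc R) :
  exists phi, forall f, ucvg U (fun n => f (z n)) (gelfand f phi).
Proof.
pose F f := ulim U (fun n => f (z n)).
have FE f : ucvg U (fun n => f (z n)) (F f).
  apply: (@ultra_bounded_cvg _ _ _ _ _ (rnorm f)).
  by apply: filterE => n; exact: Hinf_ub.
have Fchar : is_character F.
  split.
  - move=> a f g; apply: ulimE; rewrite (_ : (fun n => _) = (fun n => a * f (z n) + g (z n)))//.
    by apply: ucvgD => //; exact: ucvgZ.
  - by move=> f g; apply: ulimE; exact: ucvgM (FE f) (FE g).
  - exists 1; rewrite [F 1](_ : _ = 1) ?oner_neq0//.
    by apply: ulimE; exact: ucvg_cst.
by exists (SigSub (mem_set (Fchar : max_ideal_space (Hinf R) F))).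
Qed.

Lemma gelfand_continuous f : continuous (gelfand f : max_ideal_space (Hinf R) -> R[i]).
Proof.
move=> phi.
apply: (@continuous_comp _ _ _ (set_val : max_ideal_space (Hinf R) -> {ptws Hinf R -> R[i]})
   (fun u : {ptws Hinf R -> R[i]} => u f)).
  exact: initial_continuous.
exact: (@proj_continuous (Hinf R) (fun=> R[i]) f).
Qed.

Lemma closed_gelfand_ge f (c : R) :
  closed [set phi : max_ideal_space (Hinf R) | c <= cabs (gelfand f phi)].
Proof.
have -> : [set phi : max_ideal_space (Hinf R) | c <= cabs (gelfand f phi)] =
   gelfand f @^-1` [set w | c <= cabs w] by [].
apply: closed_comp; first by move=> phi _; exact: gelfand_continuous.
rewrite -[X in closed X]setCK; apply: open_closedC.
rewrite openE => w /= /negP; rewrite -ltNge => wc.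
apply/nbhs_ballP; exists (c - cabs w)%:C => /=; first by rewrite ltcR subr_gt0.
move=> v; rewrite -ball_normE /= cabsE ltcR => vw; apply/negP; rewrite -ltNge.
by have := cabs_dist v w; rewrite cabsC ler_norml; lra.
Qed.

(** With h from [Hinf_outer], the set E of the characters phi with
    |phi(f)| >= e or |phi(h)| >= 1 - d is a closed boundary: any g comes within
    1/(n+1) of its norm at a point z_n of the disc whose evaluation lies in E,
    and a limit of these evaluations is a character in E where g attains its
    norm. *)
Lemma silov_peak psi f (e : R) : silov_boundary (Hinf R) psi -> gelfand f psi = 0 ->
  0 < e -> exists h, [/\ forall z, cabs (h z) <= 1, gelfand h psi = 1 &
    forall z, cabs (h z * f z) <= e].
Proof.
move=> psiS f0 e0; have [h [h1 hf hK]] := Hinf_outer f e0.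
have hd d : 0 < d <= 1 -> 1 - d <= cabs (gelfand h psi).
  move=> d01.
  pose S z := e <= cabs (f z) \/ 1 - d <= cabs (h z).
  pose E : set (max_ideal_space (Hinf R)) :=
    [set phi | e <= cabs (gelfand f phi)] `|` [set phi | 1 - d <= cabs (gelfand h phi)].
  suff : is_boundary E.
    move=> EB; have [/=|//] := psiS E (conj EB (sub0set _)).
    by rewrite f0 cabs0 leNgt e0.
  split; first by apply: closedU; exact: closed_gelfand_ge.
  (* Otherwise |g| would be bounded on S, hence on the disc, by a positive number
     below its norm. *)
  have Sne g : 0 < rnorm g -> forall r, 0 < r -> exists z, S z /\ rnorm g - r < cabs (g z).
    move=> g0 r r0; apply: contrapT => H.
    pose m := Num.max (rnorm g - r) (rnorm g / 2).
    have m0 : 0 < m by rewrite lt_max divr_gt0 ?orbT.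
    have mg : m < rnorm g by rewrite gt_max; lra.
    suff : rnorm g <= m by lra.
    apply: Hinf_le; apply: (hK g m d) => // z Sz.
    rewrite leNgt; apply/negP => gz; apply: H; exists z; split=> //.
    by apply: le_lt_trans gz; rewrite le_max lexx.
  have one0 : 0 < rnorm (1 : Hinf R).
    by apply: lt_le_trans (Hinf_ub 1 point); rewrite Hinf1 cabs1.
  have Sn g n : exists z, S z /\ rnorm g - n.+1%:R^-1 < cabs (g z).
    have n0 : 0 < n.+1%:R^-1 :> R by rewrite invr_gt0.
    have [g0|g0] := ltP 0 (rnorm g); first exact: Sne.
    (* For g = 0 any point of S will do; one is obtained from the case g = 1. *)
    have [z [Sz _]] := Sne _ one0 _ n0; exists z; split=> //.
    by apply: lt_le_trans (cabs_ge0 _); rewrite subr_lt0; exact: le_lt_trans n0.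
  move=> g; have [z Hz] := choice (Sn g).
  have [U UU Un] := ultra_nat R.
  have [phi Hphi] := eval_limit z.
  exists phi.
    have [US|US] := in_ultra_setVsetC [set n | e <= cabs (f (z n))] UU.
      by left; apply: ucvg_ge (Hphi f) _.
    right; apply: ucvg_ge (Hphi h) _; apply: filterS US => n /= fn.
    by case: (Hz n) => -[].
  move=> chi; rewrite !cabsE lecR; apply: le_trans (gelfand_le chi g) _.
  apply/ler_addgt0Pr => x x0; rewrite -lerBlDr.
  apply: ucvg_ge (Hphi g) _; apply: filterS (Un _ x0) => n /= nx.
  by have [_ /ltW] := Hz n; apply: le_trans; rewrite lerD2l lerN2 ltW.
have h_ge1 : 1 <= cabs (gelfand h psi).
  apply/ler_addgt0Pr => d d0.
  have [d1|d1] := leP d 1; first by have := hd d; rewrite d0 d1 => /(_ isT); lra.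
  by have := cabs_ge0 (gelfand h psi); lra.
have c0 : gelfand h psi != 0 by rewrite -cabs_gt0; apply: lt_le_trans h_ge1.
exists ((gelfand h psi)^-1 *: h); split=> [z||z].
- rewrite HinfZ cabsM cabsV mulrC ler_pdivrMr; last by lra.
  by rewrite mul1r; apply: le_trans (h1 z) h_ge1.
- by rewrite gelfandZ mulVf.
rewrite HinfZ -mulrA cabsM cabsV mulrC ler_pdivrMr; last by lra.
by apply: le_trans (hf z) _; rewrite ler_peMr// ltW.
Qed.

End characters.

(** * Peaking functions with values near the unit interval *)

Section approximate_units.
Context (R : realType) (psi : max_ideal_space (Hinf R)).
Context (psiS : silov_boundary (Hinf R) psi).
Implicit Types (f g h : Hinf R) (z : @disc R).

Lemma silov_peak_seq (l : seq (Hinf R)) (e : R) :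
  (forall f, f \in l -> gelfand f psi = 0) -> 0 < e ->
  exists h, [/\ forall z, cabs (h z) <= 1, gelfand h psi = 1 &
    forall f, f \in l -> forall z, cabs (h z * f z) <= e].
Proof.
move=> l0 e0; elim: l l0 => [|f l IH] l0.
  by exists 1; split=> [z||//]; rewrite ?Hinf1 ?cabs1 ?gelfand1.
have [|h [h1 hpsi hl]] := IH; first by move=> g gl; apply: l0; rewrite inE gl orbT.
have [|k [k1 kpsi kf]] := @silov_peak R psi f e psiS _ e0; first by apply: l0; rewrite inE eqxx.
exists (k * h); split=> [z||g].
- by rewrite HinfM cabsM mulr_ile1 ?cabs_ge0.
- by rewrite gelfandM kpsi hpsi mulr1.
rewrite inE => /predU1P[->|gl] z; rewrite HinfM.
  by rewrite mulrAC cabsM; apply: le_trans (kf z); rewrite ler_piMr ?cabs_ge0.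
by rewrite -mulrA cabsM; apply: le_trans (hl g gl z); rewrite ler_piMl ?cabs_ge0.
Qed.

(** A new function h is taken small, by e^2, against 1 - g for the g already
    chosen.  At a point where |h| <= e it barely changes the sum; elsewhere all
    earlier g are within e of 1, so their sum is close to their number and h
    contributes at most 1 to the error. *)
Lemma peak_chain (l : seq (Hinf R)) (e : R) n :
  (forall f, f \in l -> gelfand f psi = 0) -> 0 < e ->
  exists s : seq (Hinf R), [/\ size s = n,
    forall h, h \in s -> gelfand h psi = 1,
    forall h, h \in s -> forall f, f \in l -> forall z, cabs (h z * f z) <= e ^+ 2 &
    forall z, exists2 k, (k <= n)%N &
      cabs (\sum_(h <- s) h z - k%:R) <= 1 + n%:R * e].
Proof.
move=> l0 e0; elim: n => [|n [s [sn s1 sl sz]]].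
  exists [::]; split=> // z; exists 0%N => //.
  by rewrite big_nil subrr cabs0 mul0r addr0.
have e20 : 0 < e ^+ 2 by rewrite exprn_gt0.
have [|h [h1 hpsi hl]] := @silov_peak_seq (l ++ [seq 1 - g | g <- s]) (e ^+ 2) _ e20.
  move=> f; rewrite mem_cat => /orP[/l0//|/mapP[g gs ->]].
  by rewrite gelfandB gelfand1 s1 ?subrr.
exists (h :: s); split=> [|g|g|z].
- by rewrite /= sn.
- by rewrite inE => /predU1P[->//|/s1].
- rewrite inE => /predU1P[-> f fl|/sl//]; apply: hl.
  by rewrite mem_cat fl.
rewrite big_cons -natr1 mulrDl mul1r.
have [he|he] := leP (cabs (h z)) e.
  have [k kn Hk] := sz z; exists k; first exact: leq_trans kn _.
  rewrite -addrA; apply: le_trans (cabsD _ _) _; lra.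
exists n => //.
have close g : g \in s -> cabs (g z - 1) <= e.
  move=> gs; have gm : 1 - g \in l ++ [seq 1 - g | g <- s].
    by rewrite mem_cat (map_f (fun g => 1 - g) gs) orbT.
  have := hl _ gm z.
  rewrite HinfB Hinf1 cabsM cabsC expr2 => H.
  rewrite leNgt; apply/negP => ge.
  have : e * e < cabs (h z) * cabs (g z - 1) by apply: ltr_pM => //; exact: ltW.
  lra.
have -> : h z + \sum_(g <- s) g z - n%:R = h z + \sum_(g <- s) (g z - 1).
  rewrite sumrB -addrA; congr (_ + (_ - _)).
  by rewrite -sn big_const_seq count_predT iter_addr_0.
apply: le_trans (cabsD _ _) _.
have : cabs (\sum_(g <- s) (g z - 1)) <= n%:R * e.
  apply: le_trans (ler_cabs_sum _ _ _) _.
  rewrite big_seq; apply: le_trans (ler_sum _ close) _.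
  by rewrite -big_seq big_const_seq count_predT iter_addr_0 sn mulr_natl.
by have := h1 z; lra.
Qed.

(** The average of a long enough chain is close to k/n, a point of [0, 1]. *)
Lemma peak_near_interval (l : seq (Hinf R)) (e : R) :
  (forall f, f \in l -> gelfand f psi = 0) -> 0 < e ->
  exists h, [/\ gelfand h psi = 1,
    forall f, f \in l -> forall z, cabs (h z * f z) <= e &
    forall z, cabs (h z) + cabs (1 - h z) <= 1 + e].
Proof.
move=> l0 e0.
have [d [d0 d1 de]] : exists d : R, [/\ 0 < d, d <= 1 & d <= e / 4].
  exists (Num.min 1 (e / 4)); rewrite lt_min ltr01 divr_gt0//= !ge_min !lexx.
  by rewrite orbT.
(* The distance to [0, 1] is at most 1/n + d <= e / 2, and it counts twice. *)
pose n := (Num.bound (4 / e)).+1.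
have n0 : 0 < n%:R :> R by rewrite ltr0n.
have ne : n%:R^-1 <= e / 4 :> R.
  have H := archi_boundP (ltW (divr_gt0 (ltr0Sn R 3) e0)).
  rewrite -[leRHS]invrK lef_pV2 ?posrE// ?invr_gt0 ?divr_gt0//.
  rewrite invf_div; apply: ltW; apply: lt_le_trans H _; by rewrite ler_nat.
have [s [sn s1 sl sz]] := peak_chain n l0 d0.
pose h : Hinf R := n%:R^-1 *: \sum_(g <- s) g.
have sumE (t : seq (Hinf R)) z : (\sum_(g <- t) g) z = \sum_(g <- t) g z.
  elim: t => [|g t IH]; first by rewrite !big_nil.
  by rewrite !big_cons HinfD IH.
have sumpsi (t : seq (Hinf R)) : gelfand (\sum_(g <- t) g) psi = \sum_(g <- t) gelfand g psi.
  elim: t => [|g t IH]; last by rewrite !big_cons gelfandD IH.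
  by rewrite !big_nil -(subrr 1) gelfandB subrr.
have nC : n%:R != 0 :> R[i] by rewrite pnatr_eq0.
have hE z : h z = n%:R^-1 * \sum_(g <- s) g z by rewrite /h HinfZ sumE.
have cV : cabs (n%:R^-1 : R[i]) = n%:R^-1 by rewrite cabsV cabs_nat.
exists h; split=> [|f fl z|z].
- rewrite /h gelfandZ sumpsi big_seq (eq_bigr (fun=> 1)) => [|g gs]; last exact: s1.
  by rewrite -big_seq big_const_seq count_predT iter_addr_0 sn mulVf.
- rewrite hE -mulrA cabsM cV mulr_suml ler_pdivrMl//.
  apply: le_trans (ler_cabs_sum _ _ _) _.
  apply: (@le_trans _ _ (\sum_(g <- s) e)); last first.
    by rewrite big_const_seq count_predT iter_addr_0 sn mulr_natl.
  rewrite big_seq [leRHS]big_seq; apply: ler_sum => g gs.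
  apply: le_trans (sl g gs f fl z) _.
  apply: (@le_trans _ _ d); last by lra.
  by rewrite expr2 ler_piMr// ltW.
have [k kn Hk] := sz z.
pose t : R := k%:R / n%:R.
have t0 : 0 <= t by rewrite divr_ge0.
have t1 : t <= 1 by rewrite ler_pdivrMr// mul1r ler_nat.
have ht : cabs (h z - t%:C) <= n%:R^-1 + d.
  have -> : h z - t%:C = n%:R^-1 * (\sum_(g <- s) g z - k%:R).
    by rewrite hE mulrBr /t rmorphM fmorphV /= !(rmorph_nat (real_complex R)) (mulrC k%:R).
  rewrite cabsM cV ler_pdivrMl// mulrDr divff ?gt_eqF//.
have e1 : n%:R^-1 + d <= e / 2 by rewrite (splitr (e / 2)) -!mulrA -invfM; rewrite lerD//; lra.
have H1 : cabs (h z) <= t + e / 2.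
  rewrite -[h z](subrK t%:C); apply: le_trans (cabsD _ _) _.
  by rewrite cabs_real ger0_norm// addrC lerD2l; apply: le_trans e1.
have H2 : cabs (1 - h z) <= (1 - t) + e / 2.
  have -> : 1 - h z = (1 - t)%:C - (h z - t%:C) by rewrite rmorphB rmorph1; ring.
  apply: le_trans (cabsB _ _) _.
  by rewrite cabs_real ger0_norm ?subr_ge0// lerD2l; apply: le_trans e1.
lra.
Qed.

(** An ultrafilter rather than a net, so that all bounded functions of h
    converge along it. *)
Lemma peak_ultrafilter : exists2 U : set_system (Hinf R), UltraFilter U &
  [/\ U [set h | gelfand h psi = 1],
      forall f, gelfand f psi = 0 -> forall e, 0 < e -> U [set h | rnorm (h * f) <= e] &
      forall e, 0 < e -> U [set h | forall z, cabs (h z) + cabs (1 - h z) <= 1 + e]].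
Proof.
pose D := [set p : seq (Hinf R) * R | (forall f, f \in p.1 -> gelfand f psi = 0) /\ 0 < p.2].
pose B (p : seq (Hinf R) * R) := [set h : Hinf R | [/\ gelfand h psi = 1,
    forall f, f \in p.1 -> forall z, cabs (h z * f z) <= p.2 &
    forall z, cabs (h z) + cabs (1 - h z) <= 1 + p.2]].
have PF : ProperFilter (filter_from D B).
  apply: filter_from_proper; last first.
    by move=> [l e] [/= l0 e0]; have [h Hh] := peak_near_interval l0 e0; exists h.
  apply: filter_from_filter; first by exists ([::], 1); split.
  move=> [l e] [l' e'] [/= l0 e0] [/= l'0 e'0].
  exists (l ++ l', Num.min e e').
    split=> /=; last by rewrite lt_min e0.
    by move=> f; rewrite mem_cat => /orP[/l0|/l'0].
  move=> h [/= h1 hl hz]; split; split=> //= [f fl z|z].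
  - by apply: le_trans (hl f _ z) _; rewrite ?mem_cat ?fl// ge_min lexx.
  - by apply: le_trans (hz z) _; rewrite lerD2l ge_min lexx.
  - by apply: le_trans (hl f _ z) _; rewrite ?mem_cat ?fl ?orbT// ge_min lexx orbT.
  - by apply: le_trans (hz z) _; rewrite lerD2l ge_min lexx orbT.
have [U [UU sub]] := ultraFilterLemma PF.
exists U => //; split.
- by apply: sub; exists ([::], 1); [split|move=> h []].
- move=> f f0 e e0; apply: sub; exists ([:: f], e).
    by split=> //= g; rewrite inE => /eqP ->.
  move=> h [_ /= H _]; apply: Hinf_le => z; rewrite HinfM; apply: H.
  by rewrite inE.
- by move=> e e0; apply: sub; exists ([::], e); [split|move=> h []].
Qed.

End approximate_units.

(** * The L-projection onto the multiples of a character *)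

Section dual_norm.
Context (R : realType) (X : normedModType R[i]).

Lemma dualD (F : dual X) x y : F (x + y) = F x + F y.
Proof. exact: linearD. Qed.

Lemma dualZ (F : dual X) (a : R[i]) x : F (a *: x) = a * F x.
Proof. exact: linearZ. Qed.

Lemma dualB (F : dual X) x y : F (x - y) = F x - F y.
Proof. exact: linearB. Qed.

Lemma dual_le (F : dual X) (M : R) :
  (forall x, rnorm x <= 1 -> cabs (F x) <= M) -> rnorm F <= M.
Proof.
move=> FM; rewrite -rnorm_ball dual_normE; apply: sup_norm_le.
  by exists 0; rewrite /= normr0.
by move=> x /=; rewrite -[1]/(1%:C) rnorm_ball cabsE lecR; exact: FM.
Qed.

Lemma dual_ub (F : dual X) x : cabs (F x) <= rnorm F * rnorm x.
Proof.
have [x0|x0] := eqVneq (rnorm x) 0.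
  have /eqP : `|x| = 0 by rewrite rnormE x0.
  by rewrite normr_eq0 => /eqP ->; rewrite linear0 cabs0 mulr_ge0// rnorm_ge0.
have xgt : 0 < rnorm x by rewrite lt_def x0 rnorm_ge0.
have xC : (rnorm x)%:C != 0 :> R[i] by rewrite -cabs_eq0 cabs_real normr_eq0.
pose y := (rnorm x)%:C^-1 *: x.
have y1 : rnorm y = 1.
  by rewrite rnormZ cabsV cabs_real gtr0_norm// mulVf.
have -> : x = (rnorm x)%:C *: y by rewrite scalerA divff// scale1r.
rewrite linearZ /= cabsM rnormZ y1 mulr1 cabs_real gtr0_norm// mulrC ler_wpM2r ?rnorm_ge0//.
rewrite -lecR -cabsE -rnormE dual_normE; apply: sup_norm_ub; last first.
  by rewrite /= -[1]/(1%:C) rnorm_ball y1.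
have fb : bounded_near F (nbhs (0 : X)).
  by apply: continuous_linear_bounded; exact: dual_continuous.
have [M M0 fM] := pinfty_ex_gt0 ((linear_boundedP F).1 fb).
exists M => u u1; apply: le_trans (fM u) _.
by rewrite ler_piMr// ltW.
Qed.

Lemma contraction_continuous (Y : normedModType R[i]) (f : {linear X -> Y}) :
  (forall x, rnorm (f x) <= rnorm x) -> continuous f.
Proof.
move=> f1; apply: bounded_linear_continuous; apply/linear_boundedP.
exists 1; split=> // r r1 x; apply: (@le_trans _ _ `|x|).
  by rewrite !rnormE lecR.
by rewrite ler_peMl// ltW.
Qed.

End dual_norm.

Section Mideal.
Context (R : realType) (psi : max_ideal_space (Hinf R)).
Implicit Types (f g h : Hinf R) (F G : dual (Hinf R)).

Lemma dual_of_gelfand : exists2 Psi : dual (Hinf R),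
  forall f, Psi f = gelfand f psi & rnorm Psi <= 1.
Proof.
pose p f := gelfand f psi.
have pL : linear p by exact: gelfand_linear.
pose pl : {linear Hinf R -> R[i]} := HB.pack p (GRing.isLinear.Build _ _ _ _ p pL).
have pc : continuous p.
  by apply: (@contraction_continuous _ _ _ pl) => f; exact: gelfand_le.
have pP : p \in @dual_pred R (Hinf R) by apply/asboolP; split.
exists (MkDual pP) => //; apply: dual_le => f f1.
by apply: le_trans (gelfand_le psi f) f1.
Qed.

(** For c = 0 the factor is 0, hence an inequality for its modulus. *)
Lemma unimodular_le (c : R[i]) : exists2 a : R[i], cabs a <= 1 & a * c = (cabs c)%:C.
Proof.
have [->|c0] := eqVneq c 0; first by exists 0; rewrite ?cabs0 ?mulr0.
exists ((cabs c)%:C / c); last by rewrite divfK.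
by rewrite cabsM cabsV cabs_real ger0_norm ?cabs_ge0// divff// cabs_eq0.
Qed.

(** The projection is F |-> c(F) psi with c(F) the limit of F(h).  Since
    f (1 - h) differs from f - psi(f) h by h (f - psi(f)), which tends to 0 in
    norm, c(F) and F(f) - c(F) psi(f) are the limits of F(h) and F(f (1 - h));
    with unimodular a and b, the norm of a h + b f (1 - h) is at most the
    supremum of |h| + |1 - h|. *)
Lemma ker_Mideal (U : set_system (Hinf R)) : UltraFilter U ->
  U [set h | gelfand h psi = 1] ->
  (forall f, gelfand f psi = 0 -> forall e, 0 < e -> U [set h | rnorm (h * f) <= e]) ->
  (forall e, 0 < e -> U [set h | forall z, cabs (h z) + cabs (1 - h z) <= 1 + e]) ->
  Mideal (char_ker psi).
Proof.
move=> UU U1 U0 Ue; have [Psi PsiE Psi1] := dual_of_gelfand.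
have ker f : char_ker psi f <-> Psi f = 0 by rewrite PsiE.
pose c F := ulim U F.
have cE F : ucvg U F (c F).
  apply: (@ultra_bounded_cvg _ _ _ _ _ (rnorm F * 2)).
  apply: filterS (Ue _ ltr01) => h /= H; apply: le_trans (dual_ub F h) _.
  rewrite ler_wpM2l ?rnorm_ge0//; apply: Hinf_le => z.
  by have := H z; have := cabs_ge0 (1 - h z); lra.
have cL a F G : c (a *: F + G) = a * c F + c G.
  have H : ucvg U (fun h => a * F h + G h) (a * c F + c G).
    by apply: ucvgD => //; exact: ucvgZ.
  exact: ulimE H.
have cPsi : c Psi = 1.
  apply: ulimE; apply: ucvg_eq (ucvg_cst 1) _.
  by apply: filterS U1 => h /= h1; rewrite PsiE h1.
(* For F(f (1 - h)) one takes F(f - psi(f) h), which differs from it by the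
   negligible F(h (f - psi(f))). *)
have key F f : rnorm f <= 1 -> cabs (c F) + cabs (F f - c F * Psi f) <= rnorm F.
  move=> f1; set u := F f - _.
  have [a a1 aE] := unimodular_le (c F); have [b b1 bE] := unimodular_le u.
  have F0 := rnorm_ge0 F.
  have H (e : R) : 0 < e -> cabs (c F) + cabs u <= rnorm F * (1 + e + e).
    move=> e0.
    have -> : cabs (c F) + cabs u = cabs (a * c F + b * u).
      by rewrite aE bE -rmorphD cabs_real ger0_norm// addr_ge0// cabs_ge0.
    have Hlim : ucvg U (fun h => a * F h + b * (F f - Psi f * F h)) (a * c F + b * u).
      apply: ucvgD; first exact: ucvgZ.
      apply: ucvgZ; apply: ucvgD; first exact: ucvg_cst.
      by apply: ucvgN; rewrite mulrC; exact: ucvgZ.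
    apply: ucvg_le Hlim _.
    have ker0 : gelfand (f - Psi f *: 1) psi = 0.
      by rewrite gelfandB gelfandZ gelfand1 mulr1 PsiE subrr.
    apply: filterS2 (Ue _ e0) (U0 _ ker0 _ e0) => h /= h1 h2.
    have -> : a * F h + b * (F f - Psi f * F h) = F (a *: h + b *: (f - Psi f *: h)).
      by rewrite dualD !dualZ dualB dualZ.
    apply: le_trans (dual_ub F _) _; rewrite ler_wpM2l//.
    apply: Hinf_le => z.
    rewrite HinfD !HinfZ HinfB HinfZ.
    have -> : a * h z + b * (f z - Psi f * h z) =
        (a * h z + b * (f z * (1 - h z))) + b * (h * (f - Psi f *: 1)) z.
      by rewrite HinfM HinfB HinfZ Hinf1; ring.
    apply: le_trans (cabsD _ _) _; apply: lerD.
      apply: le_trans (cabsD _ _) _; apply: le_trans (h1 z).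
      rewrite !cabsM; apply: lerD.
        by rewrite ler_piMl ?cabs_ge0.
      rewrite mulrA ler_piMl ?cabs_ge0// mulr_ile1 ?cabs_ge0//.
      by apply: le_trans (Hinf_ub f z) f1.
    rewrite cabsM; apply: le_trans (le_trans (Hinf_ub _ z) h2).
    by rewrite ler_piMl ?cabs_ge0.
  apply/ler_addgt0Pr => e e0.
  have d0 : 0 < e / (2 * (rnorm F + 1)) by rewrite divr_gt0// mulr_gt0// ltr_wpDl.
  apply: le_trans (H _ d0) _.
  rewrite -addrA mulrDr mulr1 lerD2l.
  have -> : rnorm F * (e / (2 * (rnorm F + 1)) + e / (2 * (rnorm F + 1))) =
    e * (rnorm F / (rnorm F + 1)) by field; rewrite gt_eqF// ltr_wpDl.
  by rewrite ler_piMr ?(ltW e0)// ler_pdivrMr ?mul1r ?lerDl// ltr_wpDl.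
have cF F : cabs (c F) <= rnorm F.
  have := key F 0; rewrite {1}/rnorm normr0 /= => /(_ ler01).
  by have := cabs_ge0 (F 0 - c F * Psi 0); lra.
pose p F := c F *: Psi.
have pL : linear p.
  by move=> a F G; rewrite /p cL scalerDl scalerA.
pose P : {linear dual (Hinf R) -> dual (Hinf R)} := HB.pack p (GRing.isLinear.Build _ _ _ _ p pL).
have PE F : P F = c F *: Psi by [].
have pF F : rnorm (c F *: Psi) <= cabs (c F).
  by rewrite rnormZ ler_piMr ?cabs_ge0.
split.
- rewrite (_ : char_ker psi = Psi @^-1` [set 0]); last first.
    by apply/seteqP; split=> f /ker.
  apply: closed_comp; first by move=> f _; exact: dual_continuous.
  by apply: accessible_closed_set1; apply: hausdorff_accessible; exact: norm_hausdorff.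
- by apply/ker; rewrite linear0.
- by move=> a f g /ker f0 /ker g0; apply/ker; rewrite dualD dualZ f0 g0 mulr0 addr0.
exists P; split.
- apply: contraction_continuous => F; rewrite PE.
  exact: le_trans (pF F) (cF F).
- move=> F; rewrite !PE.
  have := cL (c F) Psi 0; rewrite addr0 cPsi mulr1 => ->.
  by rewrite (_ : c 0 = 0) ?addr0//; apply: ulimE; exact: ucvg_cst.
- apply/seteqP; split=> F.
    by move=> [G _ <-] f /ker f0; rewrite PE /= -[LHS]/(c G * Psi f) f0 mulr0.
  move=> FC; exists F => //; rewrite PE.
  have FE : F = F 1 *: Psi.
    apply/val_inj/funext => f; rewrite -[RHS]/(F 1 * Psi f).
    have : F (f - Psi f *: 1) = 0.
      by apply: FC; apply/ker; rewrite dualB dualZ (PsiE 1) gelfand1 mulr1 subrr.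
    by rewrite dualB dualZ => /eqP; rewrite subr_eq0 mulrC => /eqP.
  have := cL (F 1) Psi 0; rewrite addr0 -FE cPsi mulr1 => ->.
  by rewrite (_ : c 0 = 0) ?addr0 -?FE//; apply: ulimE; exact: ucvg_cst.
- move=> F; apply/eqP; rewrite eq_le; apply/andP; split; last first.
    by have := ler_normD (P F) (F - P F); rewrite subrKC.
  rewrite !rnormE -rmorphD lecR /=.
  suff : rnorm (F - P F) <= rnorm F - cabs (c F).
    by have := pF F; rewrite -PE; lra.
  apply: dual_le => f f1.
  by have := key F f f1; rewrite -[(F - P F) f]/(F f - c F * Psi f); lra.
Qed.

End Mideal.

Theorem proposition3p3 (R : realType) (psi : max_ideal_space (Hinf R)) :
  silov_boundary (Hinf R) psi -> Mideal (char_ker psi).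
Proof.
move=> /peak_ultrafilter[U UU [U1 U0 Ue]]; exact: ker_Mideal UU U1 U0 Ue.
Qed.
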